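(* Let $0<p<1$. (a) There exists a constant $c_p$, depending only on $p$, such that for every $F\in H_p(G)$ and every $n\in\mathbb{N}_+$ $$\|S_nF\|_{H_p}\le c_p\,\bigl(n\,\mu\{\operatorname{supp}(D_n)\}\bigr)^{1/p-1}\,\|F\|_{H_p}.$$ (b) Let $\{m_k:k\ge 0\}$ be any increasing sequence of positive integers such that $\sup_{k\in\mathbb{N}} m_k\,\mu\{\operatorname{supp}(D_{m_k})\}=\infty$, and let $\Phi:\mathbb{N}_+\to[1,\infty)$ be any nondecreasing function satisfying $$\limsup_{k\to\infty}\frac{\bigl(m_k\,\mu\{\operatorname{supp}(D_{m_k})\}\bigr)^{1/p-1}}{\Phi(m_k)}=\infty .$$ Then there exists a martingale $F\in H_p(G)$ such that $$\sup_{k\in\mathbb{N}}\left\|\frac{S_{m_k}F}{\Phi(m_k)}\right\|_{L_{p,\infty}}=\infty .$$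
   Context: $\mathbb{N}_+$ is the set of positive integers and $\mathbb{N}=\mathbb{N}_+\cup\{0\}$. $G=\prod_{k=0}^\infty Z_2$ is the dyadic (Walsh) group, i.e. the set of sequences $x=(x_0,x_1,\dots)$, $x_k\in\{0,1\}$, with coordinatewise addition mod 2, product topology, and normalized Haar measure $\mu$ (the product of the measures giving mass $1/2$ to each point of $Z_2$). Put $I_0(x)=G$, $I_n(x)=\{y\in G: y_0=x_0,\dots,y_{n-1}=x_{n-1}\}$, and let $\zeta_n$ be the $\sigma$-algebra generated by $\{I_n(x):x\in G\}$. Rademacher functions: $r_k(x)=(-1)^{x_k}$. Walsh functions: $w_n(x)=\prod_{k\ge0}r_k(x)^{n_k}$, where $n=\sum_{k\ge0}n_k2^k$, $n_k\in\{0,1\}$. Dirichlet kernels: $D_n=\sum_{k=0}^{n-1}w_k$ for $n\in\mathbb{N}_+$; $\operatorname{supp}(D_n)=\{x\in G:D_n(x)\ne0\}$ (this set is clopen, as $D_n$ is locally constant). A martingale $F=(F_n,n\in\mathbb{N})$ is a martingale with respect to $(\zeta_n)_{n\in\mathbb N}$. Its maximal function is $F^*=\sup_n|F_n|$; for $0<p<\infty$, $H_p(G)$ is the space of martingales with $\|F\|_{H_p}:=\|F^*\|_p<\infty$, where $\|f\|_p^p=\int_G|f|^p\,d\mu$. The weak quasi-norm is $\|f\|_{L_{p,\infty}}^p=\sup_{\lambda>0}\lambda^p\mu(|f|>\lambda)$. Walsh–Fourier coefficients of a martingale: $\widehat F(k)=\lim_{n\to\infty}\int_GF_nw_k\,d\mu$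 (the limit always exists). Partial sums: $S_nF=\sum_{k=0}^{n-1}\widehat F(k)w_k$; in particular $S_{2^n}F=F_n$. An integrable function $f$ (such as $S_nF$) is identified with the martingale $(E(f\mid\zeta_n))_{n}$ of its conditional expectations when its $H_p$ quasi-norm is taken. *)

(* Defs.v *)
From HB Require Import structures.
From mathcomp Require Import all_boot all_order all_algebra.
From mathcomp Require Import all_classical all_reals all_analysis.
From mathcomp Require Import measurable_realfun.
From mathcomp Require Import zify ring lra.

Set Implicit Arguments.
Unset Strict Implicit.
Unset Printing Implicit Defensive.
Import Order.TTheory GRing.Theory Num.Theory.
Import numFieldNormedType.Exports.
Local Open Scope classical_set_scope.
Local Open Scope ring_scope.

Definition dyadic_interval (n : nat) (x : nat -> bool) : set (nat -> bool) :=
  [set y | forall k, (k < n)%N -> y k = x k].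

Definition dyadic_intervals : set (set (nat -> bool)) :=
  [set A | exists n x, A = dyadic_interval n x].

(* The measurable sets are those of the product sigma-algebra, which is also
   the Borel sigma-algebra of the product topology. *)
Definition walsh_group := g_sigma_algebraType dyadic_intervals.

Definition zeta (n : nat) : set (set walsh_group) :=
  <<s range (dyadic_interval n) >>.

(* Existence of the product measure: it is the law of the sequence of binary
   digits of a uniformly distributed point of [0, 1[. *)
Section haar.
Context {R : realType}.

Let digits (t : R) : walsh_group := fun k => odd (Num.truncn (2 ^+ k.+1 * t)).

Fixpoint prefix_val (x : nat -> bool) (n : nat) : nat :=
  if n is n'.+1 then ((prefix_val x n').*2 + x n')%N else 0%N.

Lemma truncn_double (t : R) : 0 <= t ->
  Num.truncn (2 * t) = ((Num.truncn t).*2 + odd (Num.truncn (2 * t)))%N.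
Proof.
move=> t0; suff h : (Num.truncn (2 * t))./2 = Num.truncn t.
  by rewrite -h addnC odd_double_half.
have t20 : 0 <= 2 * t by rewrite mulr_ge0.
have /andP[h1 h2] := truncn_itv t20.
apply/esym/eqP; rewrite truncn_eq//.
set m := Num.truncn (2 * t) in h1 h2 *.
have mE := odd_double_half m.
move: h1 h2; rewrite -{1 2}mE -mul2n -!natr1 natrD natrM.
case: (odd m) => /=; move=> h1 h2; apply/andP; split; lra.
Qed.

Lemma digits_dyadic_interval (t : R) n x : 0 <= t < 1 ->
  dyadic_interval n x (digits t) <-> Num.truncn (2 ^+ n * t) = prefix_val x n.
Proof.
move=> /andP[t0 t1]; elim: n => [|n IH].
  rewrite expr0 mul1r /=; split => // _; apply/eqP.
  by rewrite truncn_eq// t0.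
have tn0 : 0 <= 2 ^+ n * t by rewrite mulr_ge0// exprn_ge0.
have := truncn_double tn0; rewrite mulrA -exprS => E.
split => /= h.
  rewrite E -(h n)//; congr (_.*2 + _)%N.
  by apply/IH => k kn; apply: h; rewrite ltnS ltnW.
have [h1 h2] : Num.truncn (2 ^+ n * t) = prefix_val x n /\ digits t n = x n.
  rewrite /digits; move: h; rewrite E.
  set a := Num.truncn _; set b := odd _; case: b; case: (x n); lia.
move=> k; rewrite ltnS leq_eqVlt => /predU1P[->//|]; by move/IH : h1; apply.
Qed.

Lemma digits_preimage n x :
  `[0, 1[%classic `&` digits @^-1` dyadic_interval n x =
  `[(prefix_val x n)%:R / 2 ^+ n, (prefix_val x n).+1%:R / 2 ^+ n[%classic.
Proof.
have p2 : 0 < 2 ^+ n :> R by rewrite exprn_gt0.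
have vlt : ((prefix_val x n).+1 <= 2 ^ n)%N.
  elim: n {p2} => [|n IH]//=; rewrite expnS; case: (x n); lia.
apply/seteqP; split => t /=; rewrite !in_itv/=.
  move=> [t01 /(digits_dyadic_interval _ _ t01)] /eqP.
  have /andP[t0 _] := t01.
  by rewrite truncn_eq ?mulr_ge0 ?exprn_ge0// ler_pdivrMr// ltr_pdivlMr// mulrC.
rewrite ler_pdivrMr// ltr_pdivlMr// => /andP[h1 h2].
have t0 : 0 <= t by rewrite -(pmulr_lge0 _ p2) (le_trans _ h1).
have t1 : t < 1.
  rewrite -(ltr_pM2r p2) mul1r (lt_le_trans h2)//.
  by rewrite -natrX ler_nat.
have t01 : 0 <= t < 1 by rewrite t0.
split => //; apply/(digits_dyadic_interval _ _ t01)/eqP.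
by rewrite truncn_eq ?mulr_ge0 ?exprn_ge0// mulrC h1.
Qed.

Lemma haar_exists : exists mu : probability walsh_group R,
  forall n x, mu (dyadic_interval n x) = ((2 ^+ n)^-1)%:E.
Proof.
pose D : set (measurableTypeR R) := `[0, 1[%classic.
have mD : measurable D by exact: measurable_itv.
pose h (t : measurableTypeR R) : walsh_group :=
  if 0 <= t < 1 then digits t else (fun=> false).
have mh : measurable_fun [set: measurableTypeR R] h.
  have fD b : (fun t : R => 0 <= t < 1) @^-1` [set b] = if b then D else ~` D.
    apply/seteqP; case: b; split => t /=; rewrite /D/= in_itv/=.
    - by move=> ->.
    - by move=> ->.
    - by move=> ->.
    - by move/negP/negbTE.
  apply: measurable_fun_if => //.
  - apply: (measurable_fun_bool true) => //; rewrite setTI fD; exact: mD.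
  - rewrite setTI fD; apply: measurability => // _ [_ [n [x ->]] <-].
    by rewrite digits_preimage; exact: measurable_itv.
pose nu := pushforward (mrestr (@lebesgue_measure R) mD) h.
have nuE n x : nu (dyadic_interval n x) = ((2 ^+ n)^-1)%:E.
  rewrite /nu /pushforward /mrestr.
  transitivity (lebesgue_measure
    (`[0, 1[%classic `&` digits @^-1` dyadic_interval n x)).
    congr (lebesgue_measure _); apply/seteqP; split => t /=; rewrite /D/= in_itv/=.
      by move=> [+ t01]; rewrite /h t01.
    by move=> [t01]; rewrite /h t01.
  rewrite digits_preimage lebesgue_measure_itv/= lte_fin.
  rewrite ltr_pM2r ?invr_gt0 ?exprn_gt0// ltr_nat ltnSn.
  by rewrite -EFinB -mulrBl -natrB// subSnn mul1r.
have nuT : nu setT = 1%E.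
  rewrite (_ : setT = dyadic_interval 0 (fun=> false)) ?nuE ?expr0 ?invr1//.
  by apply/seteqP.
pose nuM : {measure set walsh_group -> \bar R} :=
  measure_function_pushforward__canonical__measure_function_Measure
    (mrestr (@lebesgue_measure R) mD) mh.
have nuMT : nuM setT = 1%E := nuT.
pose P : probability walsh_group R :=
  @dirac _ walsh_group (fun=> false) R.
exists (mnormalize nuM P) => n x.
rewrite /= /mnormalize nuMT /= onee_eq0/= invr1 mule1.
exact: nuE.
Qed.

(* Cylinders (together with the empty set) form a pi-system generating the
   measurable sets, so these values determine the measure. *)
Definition haar : probability walsh_group R := sval (cid haar_exists).

Lemma haar_dyadic_interval n x :
  haar (dyadic_interval n x) = ((2 ^+ n)^-1)%:E.
Proof. exact: (svalP (cid haar_exists)). Qed.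

End haar.
Arguments haar : clear implicits.

Section martingales.
Context {R : realType}.
Local Notation mu := (haar R).

(* g is (a version of) the conditional expectation E(f | zeta_n) of an
   integrable function f. *)
Definition is_condexp (n : nat) (f g : walsh_group -> R) : Prop :=
  [/\ forall B : set R, measurable B -> zeta n (g @^-1` B),
      mu.-integrable setT (EFin \o g) &
      forall A, zeta n A ->
        (\int[mu]_(x in A) (g x)%:E = \int[mu]_(x in A) (f x)%:E)%E].

Definition condexp (n : nat) (f : walsh_group -> R) : walsh_group -> R :=
  xget (cst 0) [set g | is_condexp n f g].

(* Martingales are real-valued.  Taking n = m gives that F n is
   zeta_n-measurable and integrable. *)
Definition martingale (F : nat -> walsh_group -> R) : Prop :=
  forall n m, (n <= m)%N -> is_condexp n (F m) (F n).

Definition maximal_function (F : nat -> walsh_group -> R) (x : walsh_group) :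
    \bar R :=
  ereal_sup (range (fun n => `|F n x|%:E)).

Definition Hp_norm (p : R) (F : nat -> walsh_group -> R) : \bar R :=
  Lnorm mu p%:E (maximal_function F).

Definition in_Hp (p : R) (F : nat -> walsh_group -> R) : Prop :=
  martingale F /\ (Hp_norm p F < +oo)%E.

(* An integrable function is identified with the martingale of its conditional
   expectations. *)
Definition Hp_norm_fun (p : R) (f : walsh_group -> R) : \bar R :=
  Hp_norm p (fun n => condexp n f).

Definition weakLp_norm (p : R) (f : walsh_group -> R) : \bar R :=
  poweR (ereal_sup [set ((l `^ p)%:E * mu [set x | (l < `|f x|)%R])%E
                   | l in [set l : R | 0 < l]]) p^-1.

Definition rademacher (k : nat) (x : walsh_group) : R := (-1) ^+ x k.

Definition binary_digit (n k : nat) : nat := odd (n %/ 2 ^ k)%N.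

(* The product is restricted to k < n since the binary digits of n of index
   k >= n vanish. *)
Definition walsh (n : nat) (x : walsh_group) : R :=
  \prod_(k < n) rademacher k x ^+ binary_digit n k.

Definition dirichlet (n : nat) (x : walsh_group) : R :=
  \sum_(k < n) walsh k x.

Definition supp_dirichlet (n : nat) : set walsh_group :=
  [set x | dirichlet n x != 0].

Definition walsh_coef (F : nat -> walsh_group -> R) (k : nat) : R :=
  limn (fun n => \int[mu]_x (F n x * walsh k x)).

Definition partial_sum (n : nat) (F : nat -> walsh_group -> R)
    (x : walsh_group) : R :=
  \sum_(k < n) walsh_coef F k * walsh k x.

Definition mu_supp_dirichlet (n : nat) : R := fine (mu (supp_dirichlet n)).

Lemma dyadic_interval_sym n x y :
  dyadic_interval n x y -> dyadic_interval n x = dyadic_interval n y.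
Proof.
by move=> xy; apply/seteqP; split => z xz k kn; rewrite xz// xy.
Qed.

Lemma zeta_saturated n A x y :
  zeta n A -> dyadic_interval n x y -> A x -> A y.
Proof.
move=> zA xy; suff h : A x <-> A y by move/h.
move: A zA; apply: smallest_sub; first split.
- by [].
- by move=> A h; split => -[_ nA]; split=> // /h.
- by move=> A h; split=> -[i _ Ai]; exists i => //; apply/h.
- move=> _ [z _ <-]; split => h k kn; first by rewrite xy// h.
  by rewrite -xy// h.
Qed.

Lemma measurable_dyadic_interval n x :
  measurable (dyadic_interval n x : set walsh_group).
Proof. by apply: sub_sigma_algebra; exists n, x. Qed.

Lemma zeta_measurable n A : zeta n A -> measurable A.
Proof.
apply: sub_sigma_algebra2 => _ [x _ <-]; by exists n, x.
Qed.

(* Conditional expectations exist (and are averages over dyadic intervals), so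
   the default value in [condexp] is never used on integrable functions. *)
Lemma is_condexp_mean n (f : walsh_group -> R) :
  mu.-integrable setT (EFin \o f) ->
  is_condexp n f (fun x => 2 ^+ n * \int[mu]_(y in dyadic_interval n x) f y).
Proof.
move=> fi; set g := (X in is_condexp _ _ X).
pose ext (a : {ffun 'I_n -> bool}) : walsh_group :=
  fun k => if insub k is Some i then a i else false.
have extK x : exists a, dyadic_interval n (ext a) x.
  exists [ffun i : 'I_n => x i] => k kn; rewrite /ext insubT/= ffunE//.
have ext_inj a b z : dyadic_interval n (ext a) z ->
    dyadic_interval n (ext b) z -> a = b.
  move=> az bz; apply/ffunP => i; have := az i (ltn_ord i).
  by rewrite bz// /ext valK.
have gE x y : dyadic_interval n x y -> g x = g y.
  by move=> /dyadic_interval_sym xy; rewrite /g xy.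
pose s (A : set walsh_group) :=
  [seq a <- enum {: {ffun 'I_n -> bool}} | ext a \in A].
have decomp A : (forall x y, dyadic_interval n x y -> A x -> A y) ->
    A = \big[setU/set0]_(a <- s A) dyadic_interval n (ext a).
  move=> satA; rewrite -bigcup_seq; apply/seteqP; split => x.
    move=> Ax; have [a xa] := extK x; exists a => //=.
    rewrite mem_filter; apply/andP; split; last by rewrite mem_enum.
    by apply/mem_set; apply: satA Ax => k kn; rewrite xa.
  by move=> [a /=]; rewrite mem_filter => /andP[/set_mem Aa _] /satA; exact.
have zsat A : (forall x y, dyadic_interval n x y -> A x -> A y) -> zeta n A.
  move=> /decomp ->; rewrite /zeta.
  elim/big_ind : _ => //.
  - exact: sigma_algebra0.
  - move=> X Y zX zY; rewrite -bigcup2E; apply: sigma_algebra_bigcup => -[//|[//|i]].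
    exact: sigma_algebra0.
  - by move=> a _; apply: sub_sigma_algebra; exists (ext a).
have zg B : zeta n (g @^-1` B).
  by apply: zsat => x y /gE /= ->.
have mg : measurable_fun setT g.
  by move=> _ B mB; rewrite setTI; apply: zeta_measurable; exact: zg.
have muI x : (mu (dyadic_interval n x) < +oo)%E.
  by rewrite haar_dyadic_interval ltry.
have fiI x : mu.-integrable (dyadic_interval n x) (EFin \o f).
  by apply: integrableS fi => //; exact: measurable_dyadic_interval.
split => //.
- apply: measurable_bounded_integrable => //.
    by apply: (le_lt_trans (probability_le1 _ _)) => //; rewrite ltry.
  exists (\sum_(a : {ffun 'I_n -> bool}) `|g (ext a)|); split; first exact: num_real.
  move=> M hM x _; apply: le_trans (ltW hM).
  have [a /gE <-] := extK x.
  by rewrite (bigD1 a)//= lerDl sumr_ge0.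
- move=> A zA; have /decomp AE : forall x y, dyadic_interval n x y -> A x -> A y.
    by move=> x y; exact: zeta_saturated.
  have tI : trivIset [set` s A] (fun a => dyadic_interval n (ext a) : set walsh_group).
    by move=> a b _ _ [z [az bz]]; exact: ext_inj az bz.
  have us : uniq (s A) by rewrite filter_uniq// enum_uniq.
  have mI a := measurable_dyadic_interval n (ext a).
  rewrite {1 2}AE !integral_bigsetU_EFin//; last 2 first.
  + exact: measurable_funS (measurable_int _ fi).
  + by apply/measurable_EFinP; exact: (measurable_funS measurableT).
  apply: eq_bigr => a _.
  transitivity (\int[mu]_(x in dyadic_interval n (ext a)) (g (ext a))%:E)%E.
    by apply: eq_integral => x; rewrite inE => /gE ->.
  rewrite integral_cst// [X in (_ * X)%E]haar_dyadic_interval -EFinM.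
  rewrite /g mulrAC mulfV ?mul1r ?expf_neq0// fineK//.
  exact: integrable_fin_num.
Qed.

Lemma condexpP n (f : walsh_group -> R) :
  mu.-integrable setT (EFin \o f) -> is_condexp n f (condexp n f).
Proof. by move=> /(is_condexp_mean n); apply: xgetI. Qed.

End martingales.

(* Main.v *)
(* Write n = 2^l q with q odd.  Then D_n is supported by I_l(0), where |D_n| is
   2^l times an odd integer, so that mu(supp D_n) = 2^-l, and the recursion
   D_2n(x) = (1 + r_0(x)) D_n(x_1, x_2, ...) gives |D_n|_p^p <= C_p 2^(-l(1-p)).

   (a) If n <= 2^N <= 2n, then S_n F = F_N * D_n is an average over 2^N cells,
   and |average|^p <= 2^(N(1-p)) average(|.|^p).  Hence
   |S_n F|_p^p <= 2^(N(1-p)) |D_n|_p^p |F_N|_p^p, which is the claimed bound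
   because the maximal function of S_n F is at most max(F^*, |S_n F|).

   (b) Take F = sum_j lambda_j 2^(h_j(1/p-1)) (D_(2^(h_j+1)) - D_(2^h_j)), where
   lambda_j^p = 2^-(j+1) and h_j is the top binary position of the j-th index n
   selected from the sequence m.  Then |F^*|_p^p <= sum_j lambda_j^p, whereas
   with n = 2^h + r one has S_n F = F_h +- lambda_j 2^(h(1/p-1)) D_r.  For a fast
   growing selection F_h is negligible and |D_r| >= 2^l on I_l(0). *)
Require Import Defs.
From mathcomp Require Import all_boot all_order all_algebra.
From mathcomp Require Import all_classical all_reals all_analysis.
From mathcomp Require Import measurable_realfun.
From mathcomp Require Import zify ring lra.
Import Order.TTheory GRing.Theory Num.Theory.
Import numFieldNormedType.Exports.
Set Implicit Arguments.
Unset Strict Implicit.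
Unset Printing Implicit Defensive.
Local Open Scope classical_set_scope.
Local Open Scope ring_scope.

(** * Walsh functions and Dirichlet kernels *)

Section sequences_of_bits.
Implicit Types x y : nat -> bool.

Definition scons (b : bool) x : nat -> bool :=
  fun k => if k is k'.+1 then x k' else b.
Definition stail x : nat -> bool := fun k => x k.+1.
Definition sadd x y : nat -> bool := fun k => x k (+) y k.

Lemma scons_stail x : scons (x 0%N) (stail x) = x.
Proof. by apply/funext => -[]. Qed.

Lemma sadd_scons b x y :
  sadd (scons b x) y = scons (b (+) y 0%N) (sadd x (stail y)).
Proof. by apply/funext => -[]. Qed.

Lemma dyadic_intervalS n x y : dyadic_interval n.+1 x y <->
  x 0%N = y 0%N /\ dyadic_interval n (stail x) (stail y).
Proof.
split=> [xy|[xy0 xy] [|k] kn]; [split=> [|k kn]; exact/esym/xy || exact: xy| |].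
  by [].
exact: xy.
Qed.

(** Dependence on the first [N] bits only. It replaces measurability for [zeta N], so that integrals
    become finite averages handled by induction on bits. *)
Definition cylindrical (T : Type) (N : nat) (f : (nat -> bool) -> T) :=
  forall x y, dyadic_interval N x y -> f x = f y.

Lemma cylindrical_comp T U N (h : T -> U) (f : (nat -> bool) -> T) :
  cylindrical N f -> cylindrical N (fun x => h (f x)).
Proof. by move=> fN x y /fN ->. Qed.

Lemma cylindrical_comp2 T U V N (h : T -> U -> V) f g :
  cylindrical N f -> cylindrical N g -> cylindrical N (fun x => h (f x) (g x)).
Proof. by move=> fN gN x y xy; rewrite (fN _ _ xy) (gN _ _ xy). Qed.

Lemma cylindrical_scons T N b (f : (nat -> bool) -> T) :
  cylindrical N.+1 f -> cylindrical N (fun x => f (scons b x)).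
Proof. by move=> fN x y xy; apply: fN; apply/dyadic_intervalS. Qed.

End sequences_of_bits.

Section walsh_functions.
Context {R : realType}.
Implicit Types x y : nat -> bool.
Local Notation walsh := (@walsh R).
Local Notation dirichlet := (@dirichlet R).

Lemma binary_digit_eq0 n k : (n < 2 ^ k)%N -> binary_digit n k = 0%N.
Proof. by move=> nk; rewrite /binary_digit divn_small. Qed.

(** All binary digits of [n] at positions from [N] on vanish, so the range of the product may be
    chosen freely. Two admissible ranges are compared inside the common range [N + n]. *)
Lemma walshE N n x : (n < 2 ^ N)%N ->
  walsh n x = \prod_(k < N) rademacher k x ^+ binary_digit n k.
Proof.
move=> nN.
have E M : (n < 2 ^ M)%N -> (M <= N + n)%N ->
    \prod_(k < M) rademacher k x ^+ binary_digit n k =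
    \prod_(k < N + n) rademacher k x ^+ binary_digit n k :> R.
  move=> nM MNn.
  rewrite (big_ord_widen _ (fun k => rademacher k x ^+ binary_digit n k : R)
    MNn).
  rewrite big_mkcond; apply: eq_bigr => k _; case: ltnP => // Mk.
  by rewrite binary_digit_eq0 ?expr0// (leq_trans nM)// leq_exp2l.
have nn : (n < 2 ^ n)%N by exact: ltn_expl.
by rewrite (E N nN (leq_addr _ _)) -(E n nn (leq_addl _ _)).
Qed.

(** The lowest digit [b] yields the factor at [x 0], and the other digits are those of [n], shifted
    by one place. The inductions on word length below rest on this. *)
Lemma walsh_double (b : bool) n x :
  walsh (b + n.*2) x = (-1) ^+ (b && x 0%N) * walsh n (stail x).
Proof.
have nN : (n < 2 ^ n.+1)%N by rewrite expnS; have := ltn_expl n (leqnn 2); lia.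
rewrite (@walshE n.+2); last by rewrite expnS; case: b; lia.
rewrite big_ord_recl (@walshE n.+1)//; congr (_ * _).
  rewrite /rademacher /binary_digit expn0 divn1 oddD odd_double addbF/= oddb.
  by case: b; case: (x 0%N).
apply: eq_bigr => i _; congr (_ ^+ _).
rewrite /binary_digit /= expnS divnMA; 
by have -> : ((b + n.*2) %/ 2 = n)%N by case: b; lia.
Qed.

Lemma walsh0 x : walsh 0 x = 1.
Proof. by rewrite /Defs.walsh big_ord0. Qed.

Lemma walsh_sadd n x y : walsh n (sadd x y) = walsh n x * walsh n y.
Proof.
rewrite /Defs.walsh -big_split; apply: eq_bigr => k _ /=; rewrite -exprMn.
by rewrite /rademacher signr_addb.
Qed.

Lemma normr_walsh n x : `|walsh n x| = 1.
Proof.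
rewrite normr_prod big1// => k _.
by rewrite normrX /rademacher normrX normrN1 !expr1n.
Qed.

Lemma walsh_cylindrical N n : (n < 2 ^ N)%N -> cylindrical N (walsh n).
Proof.
move=> nN x y xy; rewrite !(@walshE N)//; apply: eq_bigr => k _.
by rewrite /rademacher xy.
Qed.

Lemma walsh_top h j x : (j < 2 ^ h)%N ->
  walsh (2 ^ h + j) x = rademacher h x * walsh j x.
Proof.
move=> jh; rewrite (@walshE h.+1) ?expnS ?mul2n -?addnn ?ltn_add2l//.
rewrite big_ord_recr/= (@walshE h j)// mulrC /binary_digit; congr (_ * _).
  by rewrite divnDl ?dvdnn// divnn expn_gt0/= divn_small.
apply: eq_bigr => k _; congr (_ ^+ nat_of_bool _).
have kh : (k < h)%N by [].
rewrite divnDl ?dvdn_exp2l 1?ltnW// oddD -expnB 1?ltnW// oddX.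
by have -> : (h - k == 0)%N = false by lia.
Qed.

Lemma dirichletS n x : dirichlet n.+1 x = dirichlet n x + walsh n x.
Proof. by rewrite /Defs.dirichlet big_ord_recr. Qed.

Lemma dirichlet0 x : dirichlet 0 x = 0.
Proof. by rewrite /Defs.dirichlet big_ord0. Qed.

(** The Walsh functions of index 2k and 2k+1 are paired; each pair has the common factor 1 + r_0. *)
Lemma dirichlet_double n x :
  dirichlet n.*2 x = (1 + (-1) ^+ x 0%N) * dirichlet n (stail x).
Proof.
elim: n => [|n IH]; first by rewrite !dirichlet0 mulr0.
rewrite doubleS !dirichletS IH -[n.*2]add0n (walsh_double false).
by rewrite -[(_ + _).+1]add1n addnA (walsh_double true)/=; ring.
Qed.

Lemma dirichlet_cylindrical N n : (n <= 2 ^ N)%N -> cylindrical N (dirichlet n).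
Proof.
move=> nN x y xy; apply: eq_bigr => k _.
by apply: (@walsh_cylindrical N) => //; exact: leq_trans nN.
Qed.

(** Each doubling contributes a factor 2 if the current bits of [x] and [y] agree and 0 otherwise.
    As a kernel in (x, y) this is the conditional expectation on [zeta N]. *)
Lemma dirichlet_exp2 N x y :
  dirichlet (2 ^ N) (sadd x y) = 2 ^+ N * \1_(dyadic_interval N x) y.
Proof.
elim: N x y => [|N IH] x y.
  rewrite expn0 dirichletS dirichlet0 walsh0 add0r expr0 mul1r indicE.
  by rewrite mem_set.
rewrite expnS mul2n dirichlet_double.
rewrite [stail _](_ : _ = sadd (stail x) (stail y))// IH !indicE /sadd exprS.
have -> : (y \in dyadic_interval N.+1 x) =
    (x 0%N == y 0%N) && (stail y \in dyadic_interval N (stail x)).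
  apply/idP/andP => [/set_mem/dyadic_intervalS[-> ?]|[/eqP ? /set_mem ?]].
    by rewrite eqxx; split => //; exact/mem_set.
  by apply/mem_set/dyadic_intervalS.
case: (x 0%N); case: (y 0%N) => /=; ring.
Qed.

(** The kernel is a sum of [n] signs, and [t] counts the negative ones. Its parity is therefore that
    of [n], which keeps it away from 0 for odd [n]. *)
Lemma dirichlet_natr n x : exists t : nat, dirichlet n x = n%:R - 2 * t%:R.
Proof.
elim: n => [|n [t IH]]; first by exists 0%N; rewrite dirichlet0; ring.
rewrite dirichletS IH; have := normr_walsh n x.
case: (ler0P (walsh n x)) => _ E; last by exists t; rewrite E -natr1; ring.
by exists t.+1; rewrite (_ : walsh n x = -1) -?natr1; [ring|lra].
Qed.

Lemma dirichlet_odd n x : odd n -> 1 <= `|dirichlet n x|.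
Proof.
move=> on; have [t ->] := dirichlet_natr n x.
rewrite -natrM; have [tn|tn] := leqP (2 * t)%N n.
  by rewrite -natrB// normr_nat ler1n subn_gt0 ltn_neqAle tn andbT; lia.
by rewrite distrC -natrB 1?ltnW// normr_nat ler1n subn_gt0.
Qed.

Lemma dirichlet_multiple l q x : dirichlet (2 ^ l * q) x =
  2 ^+ l * \1_(dyadic_interval l (fun=> false)) x * dirichlet q (iter l stail x).
Proof.
(* Exchanging the centre and the point gives the form of [dirichlet_exp2] with [y] the zero
   sequence. *)
have -> : \1_(dyadic_interval l (fun=> false)) x =
    (\1_(dyadic_interval l x) (fun=> false)) :> R.
  rewrite !indicE; do 2 congr (_ _); apply/idP/idP => /set_mem h; 
    apply/mem_set => k kl; exact/esym/(h k kl).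
rewrite -dirichlet_exp2.
elim: l x => [|l IH] x.
  by rewrite expn0 mul1n dirichletS dirichlet0 walsh0 add0r mul1r.
rewrite expnS -mulnA !mul2n !dirichlet_double IH mulrA iterSr; congr (_ * _ * _).
by rewrite /sadd addbF.
Qed.

Lemma dirichlet_decomp n x : (0 < n)%N ->
  exists2 q, odd q & dirichlet n x =
    2 ^+ logn 2 n * \1_(dyadic_interval (logn 2 n) (fun=> false)) x *
    dirichlet q (iter (logn 2 n) stail x).
Proof.
move=> n0; have [q] := pfactor_coprime (isT : prime 2) n0.
rewrite coprime2n => oq nE; exists q => //.
by rewrite {1}nE mulnC dirichlet_multiple.
Qed.

Lemma supp_dirichletE n : (0 < n)%N ->
  @supp_dirichlet R n = dyadic_interval (logn 2 n) (fun=> false).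
Proof.
move=> n0; apply/seteqP; split=> x /=; rewrite /supp_dirichlet /=;
  have [q oq ->] := dirichlet_decomp x n0; rewrite indicE.
  by case: (boolP (x \in _)) => [/set_mem//|_]; rewrite mulr0 mul0r eqxx.
move=> xl; rewrite mem_set// mulr1 mulf_neq0 ?expf_neq0//.
by rewrite -normr_gt0 (lt_le_trans ltr01)// dirichlet_odd.
Qed.

Lemma dirichlet_supp_ge n x : (0 < n)%N ->
  dyadic_interval (logn 2 n) (fun=> false) x ->
  2 ^+ logn 2 n <= `|dirichlet n x|.
Proof.
move=> n0 xl; have [q oq ->] := dirichlet_decomp x n0.
rewrite indicE mem_set// mulr1 normrM ger0_norm ?exprn_ge0//.
by rewrite ler_peMr ?exprn_ge0// dirichlet_odd.
Qed.

End walsh_functions.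

(** * Averages over words of fixed length *)

Section mean.
Context {R : realType}.
Implicit Types (x y : nat -> bool) (f g : (nat -> bool) -> R).
Local Notation walsh := (@walsh R).
Local Notation dirichlet := (@dirichlet R).

(* The average of [f] over the [2 ^ N] words of length [N], padded by zeros. *)
Fixpoint mean N f : R :=
  if N is N'.+1 then
    (mean N' (fun x => f (scons false x)) +
     mean N' (fun x => f (scons true x))) / 2
  else f (fun=> false).

Lemma eq_mean N f g : f =1 g -> mean N f = mean N g.
Proof. by move=> /funext ->. Qed.

Lemma meanD N f g : mean N (fun x => f x + g x) = mean N f + mean N g.
Proof. by elim: N f g => [|N IH] f g //=; rewrite !IH; field. Qed.

Lemma meanZ N a f : mean N (fun x => a * f x) = a * mean N f.
Proof. by elim: N f => [|N IH] f //=; rewrite !IH; field. Qed.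

Lemma mean_cst N (a : R) : mean N (fun=> a) = a.
Proof. by elim: N => [|N IH] //=; rewrite !IH; field. Qed.

Lemma mean_sum (I : Type) (s : seq I) N (f : I -> (nat -> bool) -> R) :
  mean N (fun x => \sum_(i <- s) f i x) = \sum_(i <- s) mean N (f i).
Proof.
elim: s => [|i s IH].
  by rewrite big_nil (@eq_mean _ _ (fun=> 0)) ?mean_cst// => x; rewrite big_nil.
rewrite big_cons -IH -meanD; apply: eq_mean => x; by rewrite big_cons.
Qed.

Lemma ler_mean N f g : (forall x, f x <= g x) -> mean N f <= mean N g.
Proof.
elim: N f g => [|N IH] f g fg //=.
by rewrite ler_pM2r ?invr_gt0// lerD// IH.
Qed.

Lemma mean_ge0 N f : (forall x, 0 <= f x) -> 0 <= mean N f.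
Proof. by move=> f0; rewrite -(mean_cst N 0) ler_mean. Qed.

Lemma mean_exchange N M (f : (nat -> bool) -> (nat -> bool) -> R) :
  mean N (fun x => mean M (f x)) = mean M (fun y => mean N (f ^~ y)).
Proof.
elim: N f => [|N IH] f //=.
rewrite !IH -meanD mulrC -meanZ; apply: eq_mean => y; by rewrite mulrC.
Qed.

(** Translation by [y] either fixes or swaps the two halves of the words at each bit: invariance of
    Haar measure in finite form. *)
Lemma mean_sadd N f y : cylindrical N f ->
  mean N (fun x => f (sadd x y)) = mean N f.
Proof.
elim: N f y => [|N IH] f y fN /=; first exact: fN.
rewrite !(eq_mean N (fun x => congr1 f (sadd_scons _ x y))).
rewrite !(IH (fun x => f (scons _ x))); try exact: cylindrical_scons.
by case: (y 0%N) => /=; rewrite // addrC.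
Qed.

(** Exactly one of the words of length [N] has [x] in its cell, and its weight 2^-N in the average
    is cancelled by the factor 2^N. *)
Lemma mean_dirac N f x : cylindrical N f ->
  f x = mean N (fun y => f y * (2 ^+ N * \1_(dyadic_interval N y) x)).
Proof.
elim: N f x => [|N IH] f x fN /=.
  by rewrite indicE mem_set// expr0 !mulr1; exact: fN.
rewrite -{1}[x]scons_stail.
have E b : mean N (fun y => f (scons b y) *
      (2 ^+ N.+1 * \1_(dyadic_interval N.+1 (scons b y)) x)) =
    (x 0%N == b)%:R * 2 * mean N (fun y => f (scons b y) *
      (2 ^+ N * \1_(dyadic_interval N y) (stail x))).
  rewrite -meanZ; apply: eq_mean => y; rewrite !indicE exprS.
  have -> : (x \in dyadic_interval N.+1 (scons b y)) =
      (x 0%N == b) && (stail x \in dyadic_interval N y).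
    apply/idP/andP => [/set_mem/dyadic_intervalS[/= -> ?]|[/eqP ? /set_mem ?]].
      by rewrite eqxx; split => //; exact/mem_set.
    by apply/mem_set/dyadic_intervalS.
  by rewrite -mulnb natrM; ring.
rewrite !E -!(IH (fun y => f (scons _ y))); try exact: cylindrical_scons.
by case: (x 0%N) => /=; field.
Qed.

Lemma mean_walsh N j k : (j < 2 ^ N)%N -> (k < 2 ^ N)%N ->
  mean N (fun x => walsh j x * walsh k x) = (j == k)%:R.
Proof.
elim: N j k => [|N IH] j k jN kN /=.
  move: jN kN; rewrite expn0 !ltnS !leqn0 => /eqP -> /eqP ->.
  by rewrite !walsh0 mulr1.
move: jN kN; rewrite -{1 2 3}(odd_double_half j) -{1 2 3}(odd_double_half k).
move=> jN kN.
under eq_mean do rewrite !walsh_double /= !andbF !mul1r.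
under [X in _ + X]eq_mean do rewrite !walsh_double /= !andbT mulrACA.
rewrite expnS in jN kN.
rewrite meanZ IH; try lia.
have -> : (j == k) = (odd j == odd k) && (j./2 == k./2).
  rewrite -{1}(odd_double_half j) -{1}(odd_double_half k).
  by apply/idP/idP; case: (odd j); case: (odd k) => /=; lia.
by case: (odd j); case: (odd k) => /=; case: eqP => _ /=; field.
Qed.

(** The left side averages [f] over the cell of [x]; by [dirichlet_exp2] its kernel is D_(2^n)(x +
    y), which expands into products of characters. Thus cell averages are partial sums of order
    2^n. *)
Lemma mean_proj N n f x : (n <= N)%N ->
  mean N (fun y => f y * (2 ^+ n * \1_(dyadic_interval n x) y)) =
  \sum_(k < 2 ^ n) mean N (fun y => f y * walsh k y) * walsh k x.
Proof.
move=> nN.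
under eq_mean do rewrite -dirichlet_exp2.
transitivity (mean N (fun y => \sum_(k < 2 ^ n) walsh k x * (f y * walsh k y))).
  apply: eq_mean => y; rewrite /Defs.dirichlet mulr_sumr; apply: eq_bigr => k _.
  by rewrite walsh_sadd; ring.
by rewrite mean_sum; apply: eq_bigr => k _; rewrite meanZ mulrC.
Qed.

(** * Power means with exponent below 1 and the size of Dirichlet kernels *)

Context (p : R) (p_gt0 : 0 < p) (p_lt1 : p < 1).

(** For s = a + b > 0 the ratios a/s and b/s lie in [0, 1], where t <= t^p. Since the ratios sum to
    1, multiplying by s^p and adding gives the claim. *)
Lemma powRD_le (a b : R) : 0 <= a -> 0 <= b -> (a + b) `^ p <= a `^ p + b `^ p.
Proof.
move=> a0 b0; have [ab|ab] := leP (a + b) 0.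
  rewrite (_ : a + b = 0) ?powR0 ?gt_eqF ?addr_ge0 ?powR_ge0//.
  by apply/eqP; rewrite eq_le ab addr_ge0.
have h c : 0 <= c -> c <= a + b -> c / (a + b) * (a + b) `^ p <= c `^ p.
  rewrite le_eqVlt => /predU1P[<- _|c0 cab]; first by rewrite !mul0r powR_ge0.
  have cE : 0 < c / (a + b) <= 1 by rewrite divr_gt0//= ler_pdivrMr// mul1r.
  rewrite -[X in _ <= X `^ p](divfK (lt0r_neq0 ab)).
  rewrite powRM ?(ltW ab)//; last by case/andP: cE => /ltW.
  by rewrite ler_wpM2r ?powR_ge0// ger1_powR// ltW.
apply: le_trans (lerD (h _ a0 _) (h _ b0 _)); rewrite ?lerDl ?lerDr//.
by rewrite -mulrDl -mulrDl divff ?mul1r// lt0r_neq0.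
Qed.

(** A substitute for Jensen, which points the other way when p < 1: subadditivity costs a factor
    2^(1-p) at each of the [N] halvings. *)
Lemma powR_mean N f : `|mean N f| `^ p <=
  (2 ^+ N) `^ (1 - p) * mean N (fun x => `|f x| `^ p).
Proof.
elim: N f => [|N IH] f /=; first by rewrite expr0 powR1 mul1r.
rewrite normrM (ger0_norm (_ : 0 <= 2^-1)) ?invr_ge0// powRM ?invr_ge0//.
have h (a b : R) : `|a + b| `^ p <= `|a| `^ p + `|b| `^ p.
  apply: le_trans (powRD_le (normr_ge0 _) (normr_ge0 _)).
  by rewrite ge0_ler_powR ?nnegrE ?addr_ge0// ?ler_normD// ltW.
apply: le_trans (ler_wpM2r (powR_ge0 _ _) (h _ _)) _.
apply: le_trans (ler_wpM2r (powR_ge0 _ _) (lerD (IH _) (IH _))) _.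
rewrite exprS powRM ?exprn_ge0// (_ : 2^-1 `^ p = 2 `^ (1 - p) / 2).
  set u := mean _ _; set v := mean _ _; set c := _ `^ _.
  by rewrite [leLHS](_ : _ = 2 `^ (1 - p) * c * ((u + v) / 2)); [|ring].
rewrite powRB ?pnatr_eq0 ?implybT// powRr1// mulrAC mulfV// mul1r.
by rewrite -powR_inv1// -powRrM mulN1r powRN.
Qed.

(** After [powR_mean] is applied to the inner average, the two averages are exchanged and
    translation invariance makes the average of |g|^p independent of [y]. *)
Lemma mean_convolution N f g : cylindrical N g ->
  mean N (fun x => `|mean N (fun y => f y * g (sadd x y))| `^ p) <=
  (2 ^+ N) `^ (1 - p) * mean N (fun x => `|g x| `^ p) *
    mean N (fun x => `|f x| `^ p).
Proof.
move=> gN.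
apply: le_trans (ler_mean N (fun x => powR_mean _ _)) _.
rewrite meanZ -mulrA ler_wpM2l ?powR_ge0// mean_exchange -meanZ.
rewrite le_eqVlt; apply/orP; left; apply/eqP/eq_mean => y.
rewrite -(mean_sadd y (cylindrical_comp (fun t => `|t| `^ p) gN)) mulrC -meanZ.
by apply: eq_mean => x; rewrite normrM powRM.
Qed.

Lemma exp2_pred_lt1 : 0 < (2 : R) `^ (p - 1) < 1.
Proof.
rewrite powR_gt0//= -opprB powRN invf_lt1 ?powR_gt0//.
have /gt0_ltr_powR h : 0 < 1 - p by rewrite subr_gt0.
by have := h 1 2; rewrite powR1; apply; rewrite ?nnegrE ?ltr1n.
Qed.

(** Put r = 2^(p-1). Doubling the index multiplies the average by r, and passing to an odd index
    adds at most 1, because a Walsh function has modulus 1. The constant C = 1/(1-r) is the fixed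
    point of C = 1 + rC, and each of the [l] factors 2 in [n] gains one r. *)
Lemma mean_dirichlet N n l : (n <= 2 ^ N)%N -> (2 ^ l %| n)%N ->
  mean N (fun x => `|dirichlet n x| `^ p) <=
    (1 - 2 `^ (p - 1))^-1 * (2 `^ (p - 1)) ^+ l.
Proof.
have /andP[r0 r1] := exp2_pred_lt1; set r := 2 `^ (p - 1) in r0 r1 *.
have C0 : 0 < (1 - r)^-1 by rewrite invr_gt0 subr_gt0.
have C1 : 1 + r * (1 - r)^-1 = (1 - r)^-1 by field; lra.
(* The factor 1 + r_0 is 2 on words starting with 0 and vanishes on the others, so r is 2^p / 2. *)
have half M f : (mean M (fun x => `|2 * f x| `^ p) +
    mean M (fun x => `|0 * f x| `^ p)) / 2 = r * mean M (fun x => `|f x| `^ p).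
  have -> : mean M (fun x => `|2 * f x| `^ p) =
      2 `^ p * mean M (fun x => `|f x| `^ p).
    by rewrite -meanZ; apply: eq_mean => x; rewrite normrM powRM// normr_nat.
  have -> : mean M (fun x => `|0 * f x| `^ p) = 0.
    rewrite -[RHS](mean_cst M); apply: eq_mean => x.
    by rewrite mul0r normr0 powR0// gt_eqF.
  rewrite addr0 mulrAC; congr (_ * _).
  by rewrite /r powRB ?powRr1 ?pnatr_eq0 ?implybT.
elim: N n l => [|N IH] n l nN ln.
  case: n nN ln => [|[|//]] _ /=.
    by rewrite dirichlet0 normr0 powR0 ?gt_eqF// mulr_ge0 ?exprn_ge0 ?ltW.
  rewrite dvdn1 dirichletS dirichlet0 walsh0 add0r normr1 powR1.
  rewrite -[X in _ == X]/(2 ^ 0)%N eqn_exp2l// => /eqP ->.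
  by rewrite expr0 mulr1 -C1 lerDl mulr_ge0// ltW.
have E m : (m <= 2 ^ N)%N -> mean N.+1 (fun x => `|dirichlet m.*2 x| `^ p) =
    r * mean N (fun x => `|dirichlet m x| `^ p).
  move=> mN; rewrite -half /=.
  congr ((_ + _) / 2); apply: eq_mean => x;
    by rewrite dirichlet_double/= ?subrr ?expr0.
have IH' l' : (2 ^ l' %| n./2)%N ->
    mean N (fun x => `|dirichlet n./2 x| `^ p) <= (1 - r)^-1 * r ^+ l'.
  by apply: IH; rewrite expnS in nN; lia.
have n2N : (n./2 <= 2 ^ N)%N by rewrite expnS in nN; lia.
have := odd_double_half n; case: (boolP (odd n)) => on nE; rewrite /= in nE.
  have -> : l = 0%N.
    case: l ln => // l; rewrite expnS => /(dvdn_trans (dvdn_mulr _ (dvdnn 2))).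
    by rewrite dvdn2 on.
  rewrite -nE add1n expr0 mulr1 -C1 [1 + r / _]addrC.
  have /le_trans : mean N.+1 (fun x => `|dirichlet n./2.*2.+1 x| `^ p) <=
      mean N.+1 (fun x => `|dirichlet n./2.*2 x| `^ p + 1).
    apply: ler_mean => x; rewrite dirichletS.
    apply: (@le_trans _ _ ((`|dirichlet n./2.*2 x| + 1) `^ p)).
      rewrite ge0_ler_powR ?nnegrE ?addr_ge0 ?(ltW p_gt0)//.
      by rewrite -(normr_walsh n./2.*2 x) ler_normD.
    by apply: le_trans (powRD_le _ _) _; rewrite ?powR1.
  apply; rewrite meanD mean_cst E// lerD2r ler_wpM2l ?(ltW r0)//.
  by rewrite -[leRHS]mulr1 (IH' 0%N).
rewrite -nE add0n E//.
case: l ln => [|l] ln.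
  rewrite expr0 mulr1 -C1 ler_wpDl// ler_wpM2l ?(ltW r0)//.
  by rewrite -[leRHS]mulr1 (IH' 0%N).
rewrite exprS mulrCA ler_wpM2l ?(ltW r0)// IH'//.
by rewrite -(@dvdn_pmul2l 2)// -expnS mul2n -[_.*2]add0n nE.
Qed.

End mean.

(** * Integration and martingales *)

Section integration.
Context {R : realType}.
Implicit Types (x y : walsh_group) (f g : walsh_group -> R).
Local Notation mu := (haar R).
Local Notation walsh := (@walsh R).
Local Notation dirichlet := (@dirichlet R).

Lemma integral_of_mean N (g : walsh_group -> walsh_group -> R) :
  (forall y, mu.-integrable setT (EFin \o g y)) ->
  mu.-integrable setT (EFin \o (fun x => mean N (g ^~ x))) /\
  \int[mu]_x mean N (g ^~ x) = mean N (fun y => \int[mu]_x g y x).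
Proof.
elim: N g => [|N IH] g ig /=; first by split; [exact: ig|].
have [i0 E0] := IH (fun y => g (scons false y)) (fun y => ig _).
have [i1 E1] := IH (fun y => g (scons true y)) (fun y => ig _).
have isum := integrableD measurableT i0 i1.
have ihalf := integrableZl measurableT 2^-1 isum.
have -> : (fun x : walsh_group => (mean N (fun y => g (scons false y) x) +
      mean N (fun y => g (scons true y) x)) / 2) =
    (fun x => 2^-1 * (mean N (fun y => g (scons false y) x) +
      mean N (fun y => g (scons true y) x))).
  by apply/funext => x; rewrite mulrC.
split; first exact: ihalf.
by rewrite -E0 -E1 RintegralZl// RintegralD// mulrC.
Qed.

Lemma integrable_indic_interval n x (a : R) :
  mu.-integrable setT (EFin \o (fun y => a * \1_(dyadic_interval n x) y)) /\
  \int[mu]_y (a * \1_(dyadic_interval n x) y) = a / 2 ^+ n.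
Proof.
have mI := measurable_dyadic_interval n x.
have iI : mu.-integrable setT
    (EFin \o (\1_(dyadic_interval n x) : walsh_group -> R)).
  apply: integrable_indic => //; rewrite haar_dyadic_interval; exact: ltry.
split.
  exact: (integrableZl measurableT a iI).
rewrite RintegralZl// /Rintegral integral_indic// setIT; congr (_ * _).
by rewrite [X in fine X]haar_dyadic_interval.
Qed.

(** By [mean_dirac], [f] is an average over words [y] of f(y) times a normalized cell indicator, and
    each such indicator has integral 1. *)
Lemma integral_cylindrical N f : cylindrical N f ->
  mu.-integrable setT (EFin \o f) /\ \int[mu]_x f x = mean N f.
Proof.
move=> fN; pose g y x := f y * (2 ^+ N * \1_(dyadic_interval N y) x).
have gE y : g y = fun x => f y * 2 ^+ N * \1_(dyadic_interval N y) x.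
  by apply/funext => x; rewrite /g mulrA.
have [] := @integral_of_mean N g.
  by move=> y; rewrite gE; have [] := integrable_indic_interval N y (f y * 2 ^+ N).
have -> : (fun x => mean N (g ^~ x)) = f.
  by apply/funext => x; rewrite [RHS](mean_dirac x fN).
move=> fi ->; split => //; apply: eq_mean => y.
by rewrite gE (integrable_indic_interval _ _ _).2 mulfK ?expf_neq0.
Qed.

Lemma integrable_cylindrical N f : cylindrical N f ->
  mu.-integrable setT (EFin \o f).
Proof. by move=> /integral_cylindrical[]. Qed.

Lemma Rintegral_cylindrical N f : cylindrical N f -> \int[mu]_x f x = mean N f.
Proof. by move=> /integral_cylindrical[]. Qed.

Lemma measurable_cylindrical N f : cylindrical N f -> measurable_fun setT f.
Proof. by move=> /integrable_cylindrical/measurable_int/measurable_EFinP. Qed.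

Lemma integral_Rintegral f : mu.-integrable setT (EFin \o f) ->
  (\int[mu]_x (f x)%:E)%E = (\int[mu]_x f x)%:E.
Proof. by move=> fi; rewrite fineK//; exact: integrable_fin_num. Qed.

Lemma eintegral_cylindrical N f : cylindrical N f ->
  (\int[mu]_x (f x)%:E)%E = (mean N f)%:E.
Proof.
by move=> /integral_cylindrical[fi <-]; exact: integral_Rintegral.
Qed.

Lemma Rintegral_interval N n x f : (n <= N)%N -> cylindrical N f ->
  2 ^+ n * \int[mu]_(y in dyadic_interval n x) f y =
  \sum_(k < 2 ^ n) mean N (fun y => f y * walsh k y) * walsh k x.
Proof.
move=> nN fN; rewrite -mean_proj// -(Rintegral_cylindrical (N := N)); last first.
  apply: cylindrical_comp2 => // y z yz; congr (_ * _).
  rewrite !indicE; congr (_%:R); congr nat_of_bool.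
  apply/idP/idP => /set_mem h; apply/mem_set => k kn.
    by rewrite -h// yz// (leq_trans kn).
  by rewrite -h// yz// (leq_trans kn).
have mI := measurable_dyadic_interval n x.
rewrite -RintegralZl//; last first.
  by apply: (integrableS measurableT) => //; exact: integrable_cylindrical fN.
rewrite Rintegral_mkcond; apply: eq_Rintegral => y _.
by rewrite patchE indicE; case: (y \in _); rewrite /= ?mulr1 ?mulr0// mulrC.
Qed.

Lemma is_condexp_cylindrical n f g : is_condexp n f g -> cylindrical n g.
Proof.
move=> [zg _ _] x y xy.
have := zeta_saturated (zg [set g x] (measurable_set1 _)) xy.
by move=> /(_ erefl) ->.
Qed.

Lemma zeta_dyadic_interval n x : zeta n (dyadic_interval n x).
Proof. by apply: sub_sigma_algebra; exists x. Qed.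

Lemma is_condexpE n f g x : is_condexp n f g ->
  g x = 2 ^+ n * \int[mu]_(y in dyadic_interval n x) f y.
Proof.
move=> fg; have [_ _ h] := fg; have E := h _ (@zeta_dyadic_interval n x).
rewrite /Rintegral -E.
under eq_integral => y /set_mem /(is_condexp_cylindrical fg) <- do [].
rewrite integral_cst; last exact: measurable_dyadic_interval.
rewrite /= [X in (_ * X)%E]haar_dyadic_interval -EFinM /= mulrCA.
by rewrite mulfV ?mulr1 ?expf_neq0.
Qed.

(** Versions agree everywhere, not only almost everywhere: they are constant on cells, and cells
    have positive measure. *)
Lemma condexpE n f g : is_condexp n f g -> condexp n f = g.
Proof.
move=> fg; apply/funext => x; rewrite (is_condexpE x fg).
have : is_condexp n f (condexp n f) by exact: (xgetPex _ (ex_intro _ g fg)).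
by move=> /is_condexpE ->.
Qed.

(** * Walsh polynomials, their conditional expectations and the coefficients of martingales *)

Definition walsh_poly (d : nat -> R) n x := \sum_(k < n) d k * walsh k x.

Lemma walsh_poly_cylindrical (d : nat -> R) n N : (n <= 2 ^ N)%N ->
  cylindrical N (walsh_poly d n).
Proof.
move=> nN x y xy; apply: eq_bigr => k _; congr (_ * _).
by apply: (@walsh_cylindrical _ N) => //; exact: leq_trans nN.
Qed.

Lemma mean_walsh_poly d n N k : (n <= 2 ^ N)%N -> (k < 2 ^ N)%N ->
  mean N (fun y => walsh_poly d n y * walsh k y) = if (k < n)%N then d k else 0.
Proof.
move=> nN kN.
transitivity (mean N (fun y => \sum_(j < n) d j * (walsh j y * walsh k y))).
  by apply: eq_mean => y; rewrite mulr_suml; apply: eq_bigr => j _; rewrite mulrA.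
rewrite mean_sum.
under eq_bigr => j _.
  rewrite meanZ mean_walsh//; last exact: leq_trans nN.
  over.
case: ifPn => kn.
  rewrite (bigD1 (Ordinal kn))//= eqxx mulr1 big1 ?addr0// => j jk.
  by rewrite (_ : (j == k :> nat) = false) ?mulr0//; apply/negbTE.
rewrite big1// => j _; rewrite (_ : (j == k :> nat) = false) ?mulr0//.
by apply/eqP => jk; move: kn; rewrite -jk ltn_ord.
Qed.

(** By orthogonality, cell averages at level [j] keep the Walsh functions of index below 2^j and
    kill the others. *)
Lemma is_condexp_walsh_poly d n j :
  is_condexp j (walsh_poly d n) (walsh_poly d (minn n (2 ^ j))).
Proof.
pose N := maxn n j.
have nN : (n <= 2 ^ N)%N.
  by rewrite (leq_trans (leq_maxl n j))// ltnW// ltn_expl.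
have jN : (j <= N)%N by rewrite leq_maxr.
have pN := walsh_poly_cylindrical d nN.
have := is_condexp_mean j (integrable_cylindrical pN).
rewrite [X in is_condexp _ _ X](_ : _ = walsh_poly d (minn n (2 ^ j)))//.
apply/funext => x; rewrite (Rintegral_interval x jN pN) /walsh_poly.
rewrite (big_ord_widen _ (fun k => d k * walsh k x) (geq_minr n _)).
rewrite [RHS]big_mkcond/=.
apply: eq_bigr => k _; rewrite mean_walsh_poly//; last first.
  by apply: leq_trans (ltn_ord k) _; rewrite leq_exp2l.
by rewrite leq_min ltn_ord andbT; case: ifP => _; rewrite ?mul0r.
Qed.

Lemma martingale_walsh_poly d : martingale (fun n => walsh_poly d (2 ^ n)).
Proof.
move=> n m nm; have := is_condexp_walsh_poly d (2 ^ m) n.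
by rewrite (minn_idPr _)// leq_exp2l.
Qed.

Section martingale_coefficients.
Context (F : nat -> walsh_group -> R) (martF : martingale F).

Lemma martingale_cylindrical n : cylindrical n (F n).
Proof. exact: is_condexp_cylindrical (martF (leqnn n)). Qed.

(** [F N] is a cell average of [F M], hence a Walsh polynomial with the coefficients of [F M]. So
    the sequence whose limit is [walsh_coef] is eventually constant. *)
Lemma martingale_mean_walsh N M k : (N <= M)%N -> (k < 2 ^ N)%N ->
  mean M (fun y => F M y * walsh k y) = mean N (fun y => F N y * walsh k y).
Proof.
move=> NM kN.
have FN : F N = walsh_poly (fun k => mean M (fun y => F M y * walsh k y)) (2 ^ N).
  apply/funext => x; rewrite (is_condexpE x (martF NM)).
  by rewrite (Rintegral_interval x NM (@martingale_cylindrical M)).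
by rewrite FN mean_walsh_poly// kN.
Qed.

Lemma walsh_coefE N k : (k < 2 ^ N)%N ->
  walsh_coef F k = mean N (fun y => F N y * walsh k y).
Proof.
move=> kN; apply: lim_near_cst => //; exists N => // M /= NM.
have wk : cylindrical M (walsh k).
  by apply: walsh_cylindrical; apply: leq_trans kN _; rewrite leq_exp2l.
rewrite -(martingale_mean_walsh NM kN); apply: Rintegral_cylindrical.
exact: (cylindrical_comp2 _ (@martingale_cylindrical M) wk).
Qed.

Lemma martingaleE N : F N = walsh_poly (walsh_coef F) (2 ^ N).
Proof.
apply/funext => x; rewrite (is_condexpE x (martF (leqnn N))).
rewrite (Rintegral_interval x (leqnn N) (@martingale_cylindrical N)).
by apply: eq_bigr => k _; rewrite (walsh_coefE (N := N)).
Qed.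

Lemma partial_sum_convolution n N x : (n <= 2 ^ N)%N ->
  partial_sum n F x = mean N (fun y => F N y * dirichlet n (sadd x y)).
Proof.
move=> nN.
transitivity (mean N (fun y => \sum_(k < n) walsh k x * (F N y * walsh k y))).
  rewrite mean_sum; apply: eq_bigr => k _; rewrite meanZ mulrC.
  by rewrite (walsh_coefE (N := N))// (leq_trans _ nN).
apply: eq_mean => y; rewrite mulr_sumr; apply: eq_bigr => k _.
by rewrite walsh_sadd; ring.
Qed.

(** Both [F j] and the partial sum truncate one Walsh series, and conditioning truncates it at the
    minimum of [n] and 2^j. *)
Lemma condexp_partial_sum n j :
  condexp j (partial_sum n F) = if (2 ^ j <= n)%N then F j else partial_sum n F.
Proof.
rewrite (condexpE (is_condexp_walsh_poly _ n j)) martingaleE minnC.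
by case: leqP.
Qed.

End martingale_coefficients.

Lemma walsh_coef_walsh_poly d k :
  walsh_coef (fun n => walsh_poly d (2 ^ n)) k = d k.
Proof.
have kk : (k < 2 ^ k)%N by exact: ltn_expl.
by rewrite (walsh_coefE (martingale_walsh_poly d) kk) mean_walsh_poly// kk.
Qed.

End integration.

(** * Hardy space bounds *)

Section maximal_function.
Context {R : realType}.
Implicit Types (x y : walsh_group) (F : nat -> walsh_group -> R).
Local Notation mu := (haar R).

Lemma mu_supp_dirichletE n : (0 < n)%N ->
  mu_supp_dirichlet n = (2 ^+ logn 2 n)^-1 :> R.
Proof.
move=> n0; rewrite /mu_supp_dirichlet supp_dirichletE//.
by rewrite [X in fine X]haar_dyadic_interval.
Qed.

Lemma le_maximal_function F n x : (`|F n x|%:E <= maximal_function F x)%E.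
Proof. by apply: ereal_sup_ubound; exists n. Qed.

Lemma maximal_function_ge0 F x : (0 <= maximal_function F x)%E.
Proof. by apply: le_trans (le_maximal_function F 0%N x); rewrite lee_fin. Qed.

Lemma measurable_maximal_function F : (forall n, measurable_fun setT (F n)) ->
  measurable_fun setT (maximal_function F).
Proof.
move=> mF; rewrite (_ : maximal_function F =
    fun x => esups (fun n => `|F n x|%:E) 0%N).
  apply: (measurable_fun_esups (f := fun n x => `|F n x|%:E)) => n.
  by apply/measurable_EFinP; exact: measurableT_comp.
apply/funext => x; rewrite /maximal_function /esups /sdrop.
by congr ereal_sup; apply/seteqP; split=> _ [n _ <-]; exists n.
Qed.

Lemma Hp_normE p F : (0 < p) ->
  Hp_norm p F = ((\int[mu]_x (maximal_function F x `^ p)) `^ p^-1)%E.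
Proof.
move=> p0; rewrite /Hp_norm unlock /=; congr poweR.
by apply: eq_integral => x _; rewrite gee0_abs// maximal_function_ge0.
Qed.

End maximal_function.

(** * The upper estimate for partial sums *)

Section boundedness.
Context {R : realType}.
Context (p : R) (p_gt0 : 0 < p) (p_lt1 : p < 1).
Local Notation mu := (haar R).

(** The product is the odd part of [n]. *)
Lemma natr_supp_dirichlet_ge1 n : (0 < n)%N ->
  1 <= n%:R * mu_supp_dirichlet n :> R.
Proof.
move=> n0; rewrite mu_supp_dirichletE// ler_pdivlMr ?exprn_gt0// mul1r.
by rewrite -natrX ler_nat dvdn_leq// pfactor_dvdnn.
Qed.

Lemma mean_partial_sum F N n : martingale F -> (0 < n)%N ->
  (n <= 2 ^ N <= 2 * n)%N ->
  mean N (fun x => `|partial_sum n F x| `^ p) <=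
  2 `^ (1 - p) / (1 - 2 `^ (p - 1)) * (n%:R * mu_supp_dirichlet n) `^ (1 - p) *
    mean N (fun x => `|F N x| `^ p).
Proof.
move=> martF n0 /andP[nN Nn].
under eq_mean do rewrite (partial_sum_convolution martF _ nN).
have := mean_convolution p_gt0 p_lt1 (F N) (@dirichlet_cylindrical R N n nN).
move=> /le_trans; apply; rewrite ler_wpM2r//.
  by apply: mean_ge0 => x; exact: powR_ge0.
apply: le_trans (ler_wpM2l (powR_ge0 _ _)
  (mean_dirichlet p_gt0 p_lt1 nN (pfactor_dvdnn 2 n))) _.
have /andP[_ r1] := exp2_pred_lt1 p_lt1.
rewrite mu_supp_dirichletE// mulrCA [leRHS]mulrAC [leRHS]mulrC ler_wpM2l//.
  by rewrite invr_ge0 subr_ge0 ltW.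
(* The gain of [mean_dirichlet] is the measure of the support to the power 1 - p; what remains is
   2^N <= 2n. *)
have -> : (2 `^ (p - 1)) ^+ logn 2 n = ((2 ^+ logn 2 n)^-1) `^ (1 - p) :> R.
  rewrite -opprB powRN exprVn -[in RHS]powR_inv1 ?exprn_ge0// powRAC.
  rewrite powR_inv1 ?powR_ge0//.
  by rewrite -(powR_mulrn _ (powR_ge0 _ _)) powRAC powR_mulrn.
rewrite -!powRM ?mulr_ge0 ?invr_ge0 ?exprn_ge0//.
have p10 : 0 <= 1 - p by rewrite subr_ge0 ltW.
rewrite ge0_ler_powR ?nnegrE ?mulr_ge0 ?invr_ge0 ?exprn_ge0//.
by rewrite mulrA ler_wpM2r ?invr_ge0 ?exprn_ge0// -natrX -natrM ler_nat.
Qed.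

Lemma exp2_between n : (0 < n)%N -> exists N, (n <= 2 ^ N <= 2 * n)%N.
Proof.
move=> n0; exists (trunc_log 2 n).+1.
have /andP[h1 h2] := trunc_log_bounds (isT : (1 < 2)%N) n0.
by rewrite (ltnW h2) expnS leq_pmul2l.
Qed.

Lemma Hp_norm_partial_sum F n : martingale F -> (0 < n)%N ->
  (Hp_norm_fun p (partial_sum n F) <=
   ((1 + 2 `^ (1 - p) / (1 - 2 `^ (p - 1))) `^ p^-1 *
     (n%:R * mu_supp_dirichlet n) `^ (p^-1 - 1))%:E * Hp_norm p F)%E.
Proof.
move=> martF n0; have [N nN] := exp2_between n0.
have /andP[_ r1] := exp2_pred_lt1 p_lt1.
set C := 2 `^ (1 - p) / _; set D := n%:R * _.
have C0 : 0 <= C by rewrite divr_ge0 ?powR_ge0 ?subr_ge0// ltW.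
have CD0 : 0 <= C * D `^ (1 - p) by rewrite mulr_ge0// powR_ge0.
have CD1 : 0 <= (1 + C) * D `^ (1 - p).
  by rewrite mulr_ge0 ?powR_ge0// addr_ge0.
have D1 : 1 <= D by exact: natr_supp_dirichlet_ge1.
have mF k : measurable_fun setT (F k).
  exact: measurable_cylindrical (martingale_cylindrical martF (n := k)).
have SN : cylindrical N (partial_sum n F).
  by apply: walsh_poly_cylindrical; case/andP: nN.
have cS := cylindrical_comp (fun a => `|a| `^ p) SN.
have mFs := measurable_maximal_function mF.
set S := partial_sum n F in SN cS *.
(* Each conditional expectation of S is S itself or some [F j]; the p-th power of the maximum is
   then bounded by the sum of the p-th powers. *)
have maxS x : (maximal_function (fun j => condexp j S) x `^ p <=
    maximal_function F x `^ p + (`|S x| `^ p)%:E)%E.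
  have : (maximal_function (fun j => condexp j S) x <=
      maxe (maximal_function F x) `|S x|%:E)%E.
    apply: ge_ereal_sup => _ [j _ <-]; rewrite condexp_partial_sum// le_max.
    by case: ifP => _; rewrite ?le_maximal_function// lexx orbT.
  have gp a b : (0 <= a -> a <= b -> a `^ p <= b `^ p)%E.
    move=> a0 ab; rewrite gt0_ler_poweR ?(ltW p_gt0)// in_itv/= ?leey ?andbT//.
    exact: le_trans ab.
  move=> /(gp _ _ (maximal_function_ge0 _ _))/le_trans; apply.
  case: (leP (maximal_function F x)) => _; last first.
    by rewrite leeDl// lee_fin powR_ge0.
  by rewrite -poweR_EFin leeDr// poweR_ge0.
rewrite /Hp_norm_fun !Hp_normE//.
have intFs0 : (0 <= \int[mu]_x (maximal_function F x `^ p))%E.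
  by apply: integral_ge0 => x _; exact: poweR_ge0.
have mpow (G : walsh_group -> \bar R) : measurable_fun setT G ->
    measurable_fun setT (fun x => (G x `^ p)%E).
  by move=> mG; apply: (measurableT_comp (measurable_poweR p)).
have intS : (\int[mu]_x (`|S x| `^ p)%:E <=
    (C * D `^ (1 - p))%:E * \int[mu]_x (maximal_function F x `^ p))%E.
  have cF := cylindrical_comp (fun a => `|a| `^ p)
    (martingale_cylindrical martF (n := N)).
  rewrite (eintegral_cylindrical cS).
  apply: (@le_trans _ _ ((C * D `^ (1 - p))%:E *
      (mean N (fun x => `|F N x| `^ p))%:E)%E).
    by rewrite -EFinM lee_fin mean_partial_sum.
  rewrite lee_wpmul2l ?lee_fin//.
  rewrite -(eintegral_cylindrical cF); apply: ge0_le_integral => //.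
  - by apply/measurable_EFinP; exact: measurable_cylindrical cF.
  - exact: mpow.
  - move=> x _; rewrite -poweR_EFin.
    rewrite gt0_ler_poweR ?(ltW p_gt0)// ?in_itv/= ?leey ?andbT//.
    + exact: maximal_function_ge0.
    + exact: le_maximal_function.
have mC j : measurable_fun setT (condexp j S).
  rewrite condexp_partial_sum//; case: ifP => _; first exact: mF.
  exact: measurable_cylindrical SN.
have intM : (\int[mu]_x (maximal_function (fun j => condexp j S) x `^ p) <=
    ((1 + C) * D `^ (1 - p))%:E * \int[mu]_x (maximal_function F x `^ p))%E.
  apply: (@le_trans _ _
    (\int[mu]_x (maximal_function F x `^ p + (`|S x| `^ p)%:E))%E).
    apply: ge0_le_integral => //.
    - by move=> x _; exact: poweR_ge0.
    - by apply: mpow; exact: measurable_maximal_function.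
    - apply: emeasurable_funD; first exact: mpow.
      apply/measurable_EFinP; exact: measurable_cylindrical cS.
  rewrite ge0_integralD//; last 3 first.
  - by move=> x _; exact: poweR_ge0.
  - exact: mpow.
  - apply/measurable_EFinP; exact: measurable_cylindrical cS.
  apply: le_trans (leeD (lexx _) intS) _.
  rewrite -[X in (X + _)%E]mul1e -ge0_muleDl ?lee_fin//.
  rewrite -EFinD lee_wpmul2r// lee_fin mulrDl mul1r lerD2r.
  (* The contribution of the maximal function of [F] carries the factor 1, which is absorbed because
     D >= 1. *)
  have p10 : 0 <= 1 - p by rewrite subr_ge0 ltW.
  by have := ler_powR D1 p10; rewrite powRr0.
apply: (@le_trans _ _ ((((1 + C) * D `^ (1 - p))%:E *
    \int[mu]_x (maximal_function F x `^ p)) `^ p^-1)%E).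
  rewrite gt0_ler_poweR ?invr_ge0 ?(ltW p_gt0)// in_itv/= leey andbT.
    by apply: integral_ge0 => x _; exact: poweR_ge0.
  by rewrite mule_ge0// lee_fin.
rewrite poweRM//.
rewrite poweR_EFin powRM ?powR_ge0 ?addr_ge0// -powRrM.
by rewrite mulrBl mul1r divff// gt_eqF.
Qed.

End boundedness.

(** * Lacunary martingales *)

Section lacunary_series.
Context {R : realType}.
Context (p : R) (p_gt0 : 0 < p) (p_lt1 : p < 1).
Local Notation mu := (haar R).
Local Notation zero := ((fun=> false) : nat -> bool).

(** The Walsh coefficients of the sum of c_i (D_(2^(i+1)) - D_(2^i)). Index 0 belongs to no block
    and is set apart, since its [trunc_log] would be 0. *)
Definition dyadic_blocks (c : nat -> R) (k : nat) : R :=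
  if k is 0%N then 0 else c (trunc_log 2 k).

Lemma walsh_polyS d n (x : walsh_group) :
  walsh_poly d n.+1 x = walsh_poly d n x + d n * walsh n x :> R.
Proof. by rewrite /walsh_poly big_ord_recr. Qed.

Lemma walsh_poly_block c h r (x : walsh_group) : (r <= 2 ^ h)%N ->
  walsh_poly (dyadic_blocks c) (2 ^ h + r) x =
  walsh_poly (dyadic_blocks c) (2 ^ h) x +
    c h * (rademacher h x * dirichlet r x).
Proof.
elim: r => [|r IH] rh; first by rewrite addn0 dirichlet0 !mulr0 addr0.
rewrite addnS walsh_polyS IH 1?ltnW// dirichletS walsh_top//.
have -> : dyadic_blocks c (2 ^ h + r) = c h.
  have : (0 < 2 ^ h + r)%N by rewrite addn_gt0 expn_gt0.
  rewrite /dyadic_blocks; case E : (2 ^ h + r)%N => [//|k] _; rewrite -E.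
  congr c; apply: trunc_log_eq => //.
  by rewrite leq_addr expnS mul2n -addnn ltn_add2l.
ring.
Qed.

Lemma normr_walsh_poly_blocks c n (x : walsh_group) :
  `|walsh_poly (dyadic_blocks c) (2 ^ n) x| <=
  \sum_(i < n) `|c i| * 2 ^+ i * \1_(dyadic_interval i zero) x.
Proof.
elim: n => [|n IH].
  by rewrite big_ord0 expn0 walsh_polyS /walsh_poly big_ord0 mul0r addr0 normr0.
rewrite expnS mul2n -addnn walsh_poly_block// big_ord_recr/=.
apply: le_trans (ler_normD _ _) (lerD IH _).
have -> : dirichlet (2 ^ n) x = 2 ^+ n * \1_(dyadic_interval n zero) x :> R.
  by rewrite -dirichlet_exp2; congr dirichlet; apply/funext.
rewrite !normrM /rademacher normr_sign mul1r -mulrA ler_wpM2l//.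
by rewrite !ger0_norm ?exprn_ge0.
Qed.

Lemma powR_sum_le (I : Type) (s : seq I) (a : I -> R) : (forall i, 0 <= a i) ->
  (\sum_(i <- s) a i) `^ p <= \sum_(i <- s) a i `^ p.
Proof.
move=> a0; elim: s => [|i s IH]; first by rewrite !big_nil powR0// gt_eqF.
rewrite !big_cons.
apply: le_trans (powRD_le p_gt0 p_lt1 (a0 _) (sumr_ge0 _ _)) _ => //.
by rewrite lerD2l.
Qed.

(** Subadditivity bounds the p-th power of the maximal function by the sum of (|c_i| 2^i)^p over the
    cells I_i(0) containing [x], and I_i(0) has measure 2^-i. *)
Lemma Hp_blocks (c : nat -> R) (B : R) :
  (forall n, \sum_(i < n) (`|c i| * 2 ^+ i) `^ p / 2 ^+ i <= B) ->
  in_Hp p (fun n => walsh_poly (dyadic_blocks c) (2 ^ n)).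
Proof.
move=> cB; split; first exact: martingale_walsh_poly.
set F := (X in Hp_norm p X).
pose a i : R := (`|c i| * 2 ^+ i) `^ p.
have a0 i : 0 <= a i by exact: powR_ge0.
pose T (x : walsh_group) : \bar R :=
  (\sum_(0 <= i <oo) (a i * \1_(dyadic_interval i zero) x)%:E)%E.
have aI0 i (x : walsh_group) : (0 <= (a i * \1_(dyadic_interval i zero) x)%:E)%E.
  by rewrite lee_fin mulr_ge0.
have T0 x : (0 <= T x)%E by apply: nneseries_ge0.
have FT x : (maximal_function F x `^ p <= T x)%E.
  (* Taking p-th roots reduces the claim to a bound on each [F n], since the supremum is taken
     before the power. *)
  have -> : T x = ((T x `^ p^-1) `^ p)%E.
    by rewrite -poweRrM mulVf ?poweRe1// gt_eqF.
  rewrite gt0_ler_poweR ?(ltW p_gt0)// ?in_itv/= ?leey ?andbT//.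
  - exact: maximal_function_ge0.
  - exact: poweR_ge0.
  apply: ge_ereal_sup => _ [n _ <-].
  have -> : (`|F n x|%:E = (`|F n x|%:E `^ p) `^ p^-1)%E.
    by rewrite -poweRrM mulfV ?poweRe1 ?lee_fin// gt_eqF.
  rewrite gt0_ler_poweR ?invr_ge0 ?(ltW p_gt0)// ?in_itv/= ?leey ?andbT//.
  apply: le_trans (nneseries_lim_ge n _) => //.
  rewrite sumEFin lee_fin big_mkord.
  apply: le_trans (_ : _ <= (\sum_(i < n) `|c i| * 2 ^+ i *
    \1_(dyadic_interval i zero) x) `^ p) _.
    rewrite ge0_ler_powR ?nnegrE ?(ltW p_gt0)// ?normr_walsh_poly_blocks//.
    by apply: sumr_ge0 => i _; rewrite !mulr_ge0 ?exprn_ge0.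
  apply: le_trans (powR_sum_le _ _) _.
    by move=> i; rewrite !mulr_ge0 ?exprn_ge0.
  apply: ler_sum => i _; rewrite indicE.
  by case: (x \in _); rewrite ?mulr1 ?mulr0// powR0// gt_eqF.
have mF n : measurable_fun setT (F n).
  by apply: (measurable_cylindrical (N := n)); exact: walsh_poly_cylindrical.
have mI i : measurable_fun setT
    (fun x : walsh_group => (a i * \1_(dyadic_interval i zero) x)%:E).
  exact: measurable_int (integrable_indic_interval i zero (a i)).1.
rewrite Hp_normE// poweR_lty//.
apply: (@le_lt_trans _ _ (\int[mu]_x T x)%E).
  apply: ge0_le_integral => //.
  - by move=> x _; exact: poweR_ge0.
  - apply: (measurableT_comp (measurable_poweR p)).
    exact: measurable_maximal_function.
  - exact: ge0_emeasurable_sum.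
rewrite integral_nneseries//.
apply: (@le_lt_trans _ _ B%:E); last exact: ltry.
apply: lime_le.
  by apply: is_cvg_nneseries => i _ _; apply: integral_ge0.
apply: nearW => n; rewrite big_mkord.
under eq_bigr => i _.
  rewrite integral_Rintegral; last exact: (integrable_indic_interval _ _ _).1.
  rewrite (integrable_indic_interval _ _ _).2; over.
by rewrite sumEFin lee_fin.
Qed.

(** The level [e] is tested in the supremum; its level set contains a cell of measure 2^-l. *)
Lemma weakLp_norm_ge f N l (e : R) (x : walsh_group) : 0 < e ->
  cylindrical N f -> (forall y, dyadic_interval l x y -> e < `|f y|) ->
  ((e / (2 ^+ l) `^ p^-1)%:E <= weakLp_norm p f)%E.
Proof.
move=> e0 fN ef.
have mf : measurable [set y : walsh_group | (e < `|f y|)%R].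
  have := measurable_cylindrical (cylindrical_comp (fun a => `|a|) fN).
  move=> /(_ measurableT `]e, +oo[%classic (measurable_itv _)); rewrite setTI.
  by congr measurable; apply/seteqP; split => y /=; rewrite in_itv/= andbT.
have ub := ereal_sup_ubound (ex_intro2 _ _ e e0 erefl :
  [set ((l `^ p)%:E * mu [set x | (l < `|f x|)%R])%E
  | l in [set l : R | 0 < l]] _).
apply: (@le_trans _ _ (((e `^ p)%:E * mu (dyadic_interval l x)) `^ p^-1)%E).
  rewrite [X in (_ * X)%E]haar_dyadic_interval -EFinM poweR_EFin lee_fin.
  rewrite powRM ?powR_ge0 ?invr_ge0 ?exprn_ge0// -powRrM mulfV ?gt_eqF//.
  rewrite powRr1 ?(ltW e0)//.
  by rewrite -powR_inv1 ?exprn_ge0// powRAC powR_inv1// powR_ge0.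
rewrite gt0_ler_poweR ?invr_ge0 ?(ltW p_gt0)// ?in_itv/= ?leey ?andbT//.
- by rewrite mule_ge0// lee_fin powR_ge0.
- by apply: le_trans ub; rewrite mule_ge0// lee_fin powR_ge0.
apply: le_trans ub.
rewrite lee_wpmul2l ?lee_fin ?powR_ge0//.
apply: le_measure; rewrite ?inE//.
exact: measurable_dyadic_interval.
Qed.

(** * Coefficients supported on a sparse set of blocks *)

Section lacunary_coefficients.
Context (h : nat -> nat).

(** The value 0 at [j = 0] lets [h_incr] express both that [h] increases and that [h 0] is
    positive. *)
Definition previous (j : nat) : nat := if j is j'.+1 then h j' else 0%N.

Context (h_incr : forall j, (previous j < h j)%N).

Lemma lacunary_lt i j : (i < j)%N -> (h i < h j)%N.
Proof.
elim: j => // j IH; rewrite ltnS leq_eqVlt => /predU1P[->|/IH ij].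
  exact: (h_incr j.+1).
exact: ltn_trans ij (h_incr j.+1).
Qed.

Lemma lacunary_gt j : (j < h j)%N.
Proof.
elim: j => [|j IH]; first exact: (h_incr 0%N).
exact: leq_ltn_trans IH (h_incr j.+1).
Qed.

Lemma lacunary_inj : injective h.
Proof.
by move=> i j; case: (ltngtP i j) => // /lacunary_lt + E; rewrite E ltnn.
Qed.

Definition weight (j : nat) : R := ((2^-1) ^+ j.+1) `^ p^-1.

Lemma weight_gt0 j : 0 < weight j.
Proof. by rewrite powR_gt0 // exprn_gt0// invr_gt0. Qed.

Lemma weight_le1 j : weight j <= 1.
Proof.
rewrite -(powRr0 ((2^-1) ^+ j.+1)) ger_powR ?invr_ge0 ?(ltW p_gt0)//.
by rewrite exprn_gt0 ?invr_gt0//= exprn_ile1// invf_le1// ler1n.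
Qed.

(** Nonzero only at the positions [h j]. Since j < h j, indices j <= i are enough, and a finite sum
    avoids inverting [h]. *)
Definition lacunary_coef (i : nat) : R :=
  \sum_(j < i.+1) (if h j == i then weight j * (2 ^+ i) `^ (p^-1 - 1) else 0).

Lemma lacunary_coef_ge0 i : 0 <= lacunary_coef i.
Proof.
apply: sumr_ge0 => j _; case: ifP => // _.
by rewrite mulr_ge0 ?powR_ge0.
Qed.

(** A crude bound, but free of [h]: the position [h j] is later chosen against a bound that must be
    known beforehand. *)
Lemma lacunary_coef_le i :
  lacunary_coef i <= i.+1%:R * (2 ^+ i) `^ (p^-1 - 1).
Proof.
rewrite mulr_natl -[in leRHS](card_ord i.+1) -sumr_const; apply: ler_sum => j _.
case: ifP => _; last exact: powR_ge0.
by rewrite ler_piMl ?powR_ge0 ?weight_le1.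
Qed.

Lemma lacunary_coefE j :
  lacunary_coef (h j) = weight j * (2 ^+ h j) `^ (p^-1 - 1).
Proof.
have jh : (j < (h j).+1)%N by rewrite ltnS ltnW// lacunary_gt.
rewrite /lacunary_coef (bigD1 (Ordinal jh))//= eqxx big1 ?addr0// => i ij.
case: ifP => // /eqP /lacunary_inj E; case/eqP: ij; exact: val_inj.
Qed.

Lemma lacunary_coef_gap i j :
  (previous j < i < h j)%N -> lacunary_coef i = 0.
Proof.
move=> /andP[ji ij]; rewrite /lacunary_coef big1// => k _.
case: eqP => // E; exfalso; have [kj|jk] := ltnP k j.
  case: j ji ij kj => // j /= ji _; rewrite ltnS => kj.
  move: ji; rewrite -E ltnNge; case/negP.
  by move: kj; rewrite leq_eqVlt => /predU1P[->//|/lacunary_lt/ltnW].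
move: ij; rewrite -E ltnNge; case/negP.
by move: jk; rewrite leq_eqVlt => /predU1P[->//|/lacunary_lt/ltnW].
Qed.

Lemma lacunary_coef_sum n :
  \sum_(i < n) (`|lacunary_coef i| * 2 ^+ i) `^ p / 2 ^+ i <= 1.
Proof.
have term i : (`|lacunary_coef i| * 2 ^+ i) `^ p / 2 ^+ i <=
    \sum_(j < i.+1) (if h j == i then (2^-1) ^+ j.+1 else 0).
  rewrite ger0_norm ?lacunary_coef_ge0// mulr_suml ler_pdivrMr ?exprn_gt0//.
  apply: le_trans (powR_sum_le _ _) _.
    move=> j; case: ifP => _; rewrite ?mul0r//.
    by rewrite !mulr_ge0 ?powR_ge0 ?exprn_ge0.
  rewrite mulr_suml; apply: ler_sum => j _; case: ifP => _; last first.
    by rewrite !mul0r powR0// gt_eqF.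
  have pos : 0 < (2 ^+ i : R) by rewrite exprn_gt0.
  (* The exponents 1/p - 1 and 1 add up to 1/p, so the p-th power is 2^i, cancelled by the measure
     of the cell; only the p-th power of the weight survives. *)
  rewrite -mulrA [X in _ * X](_ : _ = (2 ^+ i) `^ p^-1); last first.
    rewrite mulrC -{1}(powRr1 (ltW pos)) -powRD ?lt0r_neq0 ?implybT//.
    by congr powR; ring.
  have pK (y : R) : 0 <= y -> (y `^ p^-1) `^ p = y.
    by move=> y0; rewrite -powRrM mulVf ?powRr1// gt_eqF.
  by rewrite powRM ?powR_ge0// !pK// ?(ltW pos)// exprn_ge0 ?invr_ge0.
apply: (@le_trans _ _ (\sum_(i < n) \sum_(j < i.+1)
    (if h j == i then (2^-1) ^+ j.+1 else 0 : R))).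
  by apply: ler_sum => i _; exact: term.
apply: (@le_trans _ _ (\sum_(i < n) \sum_(j < n)
    (if h j == i then (2^-1) ^+ j.+1 else 0 : R))).
  apply: ler_sum => i _.
  rewrite (big_ord_widen _
    (fun j => if h j == i then (2^-1) ^+ j.+1 else 0 : R) (ltn_ord i)).
  rewrite big_mkcond; apply: ler_sum => j _; case: ifP => // _.
  by case: ifP => // _; rewrite exprn_ge0 ?invr_ge0.
(* Each [j] contributes to at most one [i], which leaves a geometric sum. *)
rewrite exchange_big/=.
apply: (@le_trans _ _ (\sum_(j < n) (2^-1) ^+ j.+1)).
  apply: ler_sum => j _; rewrite -big_mkcond/=.
  have [hj|hj] := ltnP (h j) n.
    by rewrite (big_pred1 (Ordinal hj)).
  rewrite big1 ?exprn_ge0 ?invr_ge0// => i /eqP E.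
  by move: hj; rewrite E leqNgt ltn_ord.
suff -> : \sum_(j < n) (2^-1) ^+ j.+1 = 1 - (2^-1) ^+ n :> R.
  by rewrite gerBl exprn_ge0 ?invr_ge0.
elim: n => [|n IH]; first by rewrite big_ord0 expr0 subrr.
by rewrite big_ord_recr/= IH exprS; field.
Qed.

Definition growth (t : nat) : R :=
  \sum_(i < t.+1) i.+1%:R * (2 ^+ i) `^ (p^-1 - 1) * 2 ^+ i.

(** The coefficients vanish strictly between [previous j] and [h j], so only blocks up to
    [previous j] contribute. *)
Lemma lacunary_partial_le j (x : walsh_group) :
  `|walsh_poly (dyadic_blocks lacunary_coef) (2 ^ h j) x| <= growth (previous j).
Proof.
apply: le_trans (normr_walsh_poly_blocks _ _ _) _.
rewrite /growth (big_ord_widen _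
  (fun i => i.+1%:R * (2 ^+ i) `^ (p^-1 - 1) * 2 ^+ i : R) (h_incr j)).
rewrite [leRHS]big_mkcond/=; apply: ler_sum => i _.
rewrite ger0_norm ?lacunary_coef_ge0// ltnS; case: leqP => ij; last first.
  by rewrite (@lacunary_coef_gap i j) ?mul0r// ij ltn_ord.
apply: (@le_trans _ _ (lacunary_coef i * 2 ^+ i)).
  rewrite ler_piMr ?mulr_ge0 ?lacunary_coef_ge0 ?exprn_ge0//.
by rewrite ler_wpM2r ?exprn_ge0 ?lacunary_coef_le.
Qed.

Lemma lacunary_weak_ge j n (Phi : R) : 0 < Phi -> trunc_log 2 n = h j ->
  (2 ^ h j < n)%N ->
  2 * growth (previous j) <= weight j * (2 ^+ h j) `^ (p^-1 - 1) ->
  ((weight j * ((n%:R * mu_supp_dirichlet n) `^ (p^-1 - 1) / Phi) /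
     (4 * 2 `^ (p^-1 - 1)))%:E <=
  weakLp_norm p (fun x => (partial_sum n
    (fun i => walsh_poly (dyadic_blocks lacunary_coef) (2 ^ i)) x / Phi)%R))%E.
Proof.
move=> Phi0 hE hn grow.
have n0 : (0 < n)%N by exact: leq_ltn_trans hn.
set a := p^-1 - 1 in grow *.
have a0 : 0 < a by rewrite subr_gt0 invf_gt1.
set l := logn 2 n; set c := weight j * _ `^ a in grow.
have c0 : 0 < c by rewrite mulr_gt0 ?weight_gt0// powR_gt0// exprn_gt0.
have /andP[_] := trunc_log_bounds (isT : (1 < 2)%N) n0; rewrite hE => nh.
pose r := (n - 2 ^ h j)%N.
have nE : (n = 2 ^ h j + r)%N by rewrite subnKC// ltnW.
have r0 : (0 < r)%N by rewrite subn_gt0.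
have rh : (r <= 2 ^ h j)%N by rewrite leq_subLR addnn -mul2n -expnS ltnW.
(* Removing the top binary digit of [n] keeps its 2-adic valuation, because the remainder [r] is not
   0. *)
have lr : logn 2 r = l.
  have rlt : (r < 2 ^ h j)%N by rewrite ltn_subLR ?addnn -?mul2n -?expnS// ltnW.
  have [q] := pfactor_coprime (isT : prime 2) r0; rewrite coprime2n => oq rE.
  have vh : (logn 2 r < h j)%N.
    rewrite -(ltn_exp2l _ _ (isT : (1 < 2)%N)) (leq_ltn_trans _ rlt)//.
    by rewrite dvdn_leq// pfactor_dvdnn.
  have nE' : n = ((2 ^ (h j - logn 2 r) + q) * 2 ^ logn 2 r)%N.
    by rewrite mulnDl -rE -expnD subnK ?(ltnW vh).
  rewrite /l [in RHS]nE' lognM ?expn_gt0// ?pfactorK//; last first.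
    by rewrite addn_gt0 expn_gt0.
  have /logn_coprime -> // : coprime 2 (2 ^ (h j - logn 2 r) + q).
  by rewrite coprime2n oddD oddX subn_eq0 leqNgt vh/= oq.
set S := (X in weakLp_norm p X).
have SE x : S x = (walsh_poly (dyadic_blocks lacunary_coef) (2 ^ h j) x +
    c * (rademacher (h j) x * dirichlet r x)) / Phi.
  congr (_ / _); rewrite /partial_sum.
  under eq_bigr do rewrite walsh_coef_walsh_poly.
  by rewrite -/(walsh_poly _ _ _) {1}nE walsh_poly_block// lacunary_coefE.
have SN : cylindrical (h j).+1 S.
  apply: (cylindrical_comp (fun a => a / Phi)).
  by apply: walsh_poly_cylindrical; exact: ltnW.
(* The main term is at least c 2^l and the earlier blocks amount to at most c/2, so half of c 2^l
   survives; the constant 4 makes the inequality strict. *)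
have lower (x : walsh_group) : dyadic_interval l zero x ->
    c * 2 ^+ l / (4 * Phi) < `|S x|.
  move=> xl; rewrite SE normrM (@gtr0_norm _ Phi^-1) ?invr_gt0//.
  rewrite [ltLHS](_ : _ = c * 2 ^+ l / 4 / Phi); last by field; rewrite gt_eqF.
  rewrite ltr_pM2r ?invr_gt0//.
  have := dirichlet_supp_ge r0; rewrite lr => /(_ R x xl) Dr.
  have := lacunary_partial_le j x.
  set P := walsh_poly _ _ x => Px.
  have : c * 2 ^+ l <= `|c * (rademacher (h j) x * dirichlet r x)|.
    rewrite normrM (gtr0_norm c0) normrM /rademacher normr_sign mul1r.
    by rewrite ler_wpM2l// ltW.
  set Q := c * (_ * _) => Qx.
  have c1 : c <= c * 2 ^+ l by rewrite ler_peMr ?(ltW c0)// exprn_ege1// ler1n.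
  have := lerB_normD Q P; rewrite (addrC Q).
  move: Px Qx c1 grow c0; set u := c * 2 ^+ l; lra.
apply: le_trans (weakLp_norm_ge _ SN lower); last first.
  by apply: divr_gt0; [exact: mulr_gt0 c0 (exprn_gt0 _ _)|rewrite mulr_gt0].
rewrite lee_fin mu_supp_dirichletE// -/l.
have l0 : 0 < (2 ^+ l : R) by rewrite exprn_gt0.
have lp : (2 ^+ l) `^ p^-1 = 2 ^+ l * (2 ^+ l) `^ a :> R.
  rewrite -{2}(powRr1 (ltW l0)) -powRD ?lt0r_neq0 ?implybT//.
  by congr powR; rewrite /a; ring.
have la : 0 < (2 ^+ l : R) `^ a by rewrite powR_gt0.
have ta : 0 < (2 : R) `^ a by rewrite powR_gt0.
have li : ((2 ^+ l)^-1 : R) `^ a = ((2 ^+ l) `^ a)^-1.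
  by rewrite -powR_inv1 ?(ltW l0)// powRAC powR_inv1// ltW.
rewrite lp powRM ?invr_ge0 ?(ltW l0)// li.
(* This is where 2^a in the constant comes from: n < 2^(h j + 1). *)
have na : n%:R `^ a <= 2 `^ a * (2 ^+ h j) `^ a :> R.
  rewrite -powRM ?exprn_ge0//.
  rewrite ge0_ler_powR ?nnegrE ?(ltW a0) ?mulr_ge0 ?exprn_ge0//.
  by rewrite -exprS -natrX ler_nat ltnW.
pose K := weight j / (2 ^+ l) `^ a / Phi / 4 / 2 `^ a.
have K0 : 0 <= K by rewrite /K !divr_ge0// ltW// weight_gt0.
rewrite [leLHS](_ : _ = K * n%:R `^ a); last first.
  by rewrite /K; field; rewrite !gt_eqF.
rewrite [leRHS](_ : _ = K * (2 `^ a * (2 ^+ h j) `^ a)); last first.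
  by rewrite /K /c; field; rewrite !gt_eqF.
exact: ler_wpM2l.
Qed.

End lacunary_coefficients.

End lacunary_series.

Lemma limn_esup_pinfty (R : realType) (u : nat -> R) :
  limn_esup (fun k => (u k)%:E) = +oo%E ->
  forall (M : R) K, exists2 k, (K <= k)%N & M < u k.
Proof.
move=> uy M K; apply: contrapT => nk.
suff : (limn_esup (fun k => (u k)%:E) <= M%:E)%E by rewrite uy leye_eq.
apply: (@le_trans _ _ (ereal_sup [set (u k)%:E | k in [set k | (K <= k)%N]])).
  apply: ereal_inf_lbound; exists [set k | (K <= k)%N] => //.
  exact: nbhs_infty_ge.
apply: ge_ereal_sup => _ [k /= Kk <-]; rewrite lee_fin leNgt.
by apply/negP => Mk; apply: nk; exists k.
Qed.

Lemma exp2_powR_unbounded (R : realType) (a M : R) : 0 < a ->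
  exists s, forall h, (s <= h)%N -> M <= (2 ^+ h) `^ a.
Proof.
move=> a0; pose y := `|M| `^ a^-1; exists (Num.truncn y).+1 => h sh.
apply: le_trans (ler_norm M) _.
have -> : `|M| = y `^ a by rewrite -powRrM mulVf ?powRr1// gt_eqF.
rewrite ge0_ler_powR ?nnegrE ?powR_ge0 ?exprn_ge0 ?(ltW a0)//.
apply: ltW; apply: lt_le_trans (truncnS_gt y) _.
by rewrite -natrX ler_nat (leq_trans sh)// ltnW// ltn_expl.
Qed.

Lemma homo_ltn_ge (m : nat -> nat) : {homo m : i j / (i < j)%N} ->
  forall k, (k <= m k)%N.
Proof.
by move=> mm; elim=> // k IH; exact: leq_ltn_trans IH (mm _ _ (ltnSn k)).
Qed.

(** * Selection of the indices and divergence *)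

Section divergence.
Context {R : realType}.
Context (p : R) (p_gt0 : 0 < p) (p_lt1 : p < 1).
Context (m : nat -> nat) (Phi : nat -> R).
Context (m_gt0 : forall k, (0 < m k)%N) (m_incr : {homo m : i j / (i < j)%N}).
Context (Phi_ge1 : forall n, (0 < n)%N -> 1 <= Phi n).

Let A k : R := ((m k)%:R * mu_supp_dirichlet (m k)) `^ (p^-1 - 1) / Phi (m k).

Context (A_unbounded : limn_esup (fun k => (A k)%:E) = +oo%E).

Lemma large_index (t : nat) (M : R) : exists k,
  [/\ (t < trunc_log 2 (m k))%N, M <= (2 ^+ trunc_log 2 (m k)) `^ (p^-1 - 1),
      M < A k & (2 ^ trunc_log 2 (m k) < m k)%N].
Proof.
have a0 : 0 < p^-1 - 1 by rewrite subr_gt0 invf_gt1.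
have [s sM] := exp2_powR_unbounded M a0.
(* As k <= m k, a large [k] forces a high top digit. Asking also for A k > 1 rules out powers of
   two, where the odd part is 1 and A k = 1 / Phi(m k) <= 1. *)
have [k Kk] := limn_esup_pinfty A_unbounded (Num.max M 1) (2 ^ maxn t.+1 s)%N.
rewrite gt_max => /andP[MA A1]; exists k.
have : (maxn t.+1 s <= trunc_log 2 (m k))%N.
  by rewrite trunc_log_max// (leq_trans Kk)// homo_ltn_ge.
rewrite geq_max => /andP[tk sk]; split => //; first exact: sM.
rewrite ltn_neqAle trunc_logP// andbT; apply/eqP => mE.
have Phi1 := Phi_ge1 (m_gt0 k).
move: A1; rewrite /A mu_supp_dirichletE// -mE pfactorK// natrX divff ?expf_neq0//.
by rewrite powR1 mE mul1r invf_gt1 ?(lt_le_trans ltr01)// ltNge Phi1.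
Qed.

Lemma divergent_martingale : exists F : nat -> walsh_group -> R,
  in_Hp p F /\ ereal_sup (range (fun k =>
    weakLp_norm p (fun x => (partial_sum (m k) F x / Phi (m k))%R))) = +oo%E.
Proof.
(* Multiplied by the weight, the threshold is j + 2 growth: the first summand makes the weak norms
   unbounded, the second makes the earlier blocks negligible. *)
pose thr j t : R := (j%:R + 2 * growth p t) / weight p j.
pose pick t M := sval (cid (large_index t M)).
(* Each index is chosen knowing the top digit of the previous one, with 0 as the start, in
   accordance with [previous]. *)
pose fix sel j := pick (if j is j'.+1 then trunc_log 2 (m (sel j')) else 0%N)
  (thr j (if j is j'.+1 then trunc_log 2 (m (sel j')) else 0%N)).
pose h j := trunc_log 2 (m (sel j)).
have selP j : [/\ (previous h j < h j)%N,
    thr j (previous h j) <= (2 ^+ h j) `^ (p^-1 - 1),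
    thr j (previous h j) < A (sel j) & (2 ^ h j < m (sel j))%N].
  have := svalP (cid (large_index (previous h j) (thr j (previous h j)))).
  by case: j.
have h_incr j : (previous h j < h j)%N by case: (selP j).
pose F n : walsh_group -> R :=
  walsh_poly (dyadic_blocks (lacunary_coef p h)) (2 ^ n).
exists F; split.
  by apply: (@Hp_blocks _ _ _ _ _ 1) => // n; exact: lacunary_coef_sum.
have growth0 t : 0 <= growth p t.
  by apply: sumr_ge0 => i _; rewrite !mulr_ge0 ?powR_ge0 ?exprn_ge0.
have lower j : ((j%:R / (4 * 2 `^ (p^-1 - 1)))%:E <=
    weakLp_norm p (fun x => (partial_sum (m (sel j)) F x / Phi (m (sel j)))%R))%E.
  have [_ thr1 thr2 hm] := selP j.
  have w0 : 0 < weight p j by exact: weight_gt0.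
  move: thr1 thr2; rewrite /thr ler_pdivrMr// ltr_pdivrMr// => thr1 thr2.
  apply: le_trans (lacunary_weak_ge p_gt0 p_lt1 h_incr _ erefl hm _).
  - rewrite lee_fin ler_pM2r ?invr_gt0 ?mulr_gt0 ?powR_gt0//.
    rewrite mulrC; apply/ltW; apply: le_lt_trans thr2.
    by rewrite lerDl mulr_ge0.
  - by rewrite (lt_le_trans ltr01)// Phi_ge1.
  - by rewrite [leRHS]mulrC; apply: le_trans thr1; rewrite lerDr.
apply: eq_infty => M; pose b : R := 4 * 2 `^ (p^-1 - 1).
have b0 : 0 < b by rewrite mulr_gt0 ?powR_gt0.
pose j := (Num.truncn (M * b)).+1.
apply: (@le_trans _ _ (j%:R / b)%:E); last first.
  by apply: le_trans (lower j) _; apply: ereal_sup_ubound; exists (sel j).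
by rewrite lee_fin ler_pdivlMr// ltW// truncnS_gt.
Qed.


End divergence.

Theorem corollary1 (R : realType) (p : R) (p_gt0 : 0 < p) (p_lt1 : p < 1) :
  (exists c : R, forall F : nat -> walsh_group -> R, in_Hp p F ->
    forall n : nat, (0 < n)%N ->
    (Hp_norm_fun p (partial_sum n F) <=
     (c * (n%:R * mu_supp_dirichlet n) `^ (p^-1 - 1))%:E * Hp_norm p F)%E)
  /\
  (forall (m : nat -> nat) (Phi : nat -> R),
    (forall k, (0 < m k)%N) ->
    {homo m : i j / (i < j)%N} ->
    ereal_sup (range (fun k =>
      ((m k)%:R * mu_supp_dirichlet (m k) : R)%:E)) = +oo%E ->
    (forall n, (0 < n)%N -> 1 <= Phi n) ->
    (forall i j, (0 < i)%N -> (i <= j)%N -> Phi i <= Phi j) ->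
    limn_esup (fun k =>
      (((m k)%:R * mu_supp_dirichlet (m k)) `^ (p^-1 - 1) / Phi (m k))%:E)
      = +oo%E ->
    exists F : nat -> walsh_group -> R,
      in_Hp p F /\
      ereal_sup (range (fun k =>
        weakLp_norm p (fun x => partial_sum (m k) F x / Phi (m k)))) = +oo%E).
Proof.
split.
  exists ((1 + 2 `^ (1 - p) / (1 - 2 `^ (p - 1))) `^ p^-1) => F [martF _] n n0.
  exact: Hp_norm_partial_sum.
move=> m Phi m_gt0 m_incr _ Phi_ge1 _ A_unbounded.
exact: divergent_martingale.
Qed.
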